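(* Let $n$ be a positive integer, let $T_n$ be a tree with $n$ vertices and $\Delta(T_n)\leq n-3$, and let $m=k(n-1)+3$ with $k$ an integer, $0\leq k\leq n-5$. (i) If $T_n$ is not isomorphic to $T(p,n-3-p)$ for any integer $p\geq 1$, then $R(T_n,K_{1,m})=m+n-3$. (ii) Let $a_1,\dots,a_d$ be all the positive divisors of $n-3$ that are at least $3$. If $m+n-3$ is not a linear combination of $n-1$, $n-2$, $n-3+a_1,\dots,n-3+a_d$, then $R(T(1,n-4),K_{1,m})=m+n-3$; otherwise $R(T(1,n-4),K_{1,m})=m+n-2$. (iii) Let $p\geq 2$ be an integer. If $m+n-3$ is not a linear combination of $2n-6$, $n-1$ and $n-2$, then $R(T(p,n-3-p),K_{1,m})=m+n-3$; otherwise $R(T(p,n-3-p),K_{1,m})=m+n-2$.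
   Context: $K_{1,m}$ is the star with $m+1$ vertices. For graphs $G,H$, the Ramsey number $R(G,H)$ is the smallest integer $N$ such that every red-blue colouring of the edges of $K_N$ contains a red copy of $G$ or a blue copy of $H$. A non-negative integer $N$ is a linear combination of positive integers $p_1,\dots,p_r$ if $N=\sum_i k_ip_i$ for some non-negative integers $k_i$. For positive integers $p,q$, $T(p,q)$ denotes the tree consisting of a vertex $v_3$ adjacent to exactly two vertices $v_2,v_4$, where $v_2$ has $p$ further neighbours that are leaves and $v_4$ has $q$ further neighbours that are leaves (equivalently, a tree with a longest path $v_1v_2v_3v_4v_5$, $d(v_3)=2$, $v_2$ and $v_4$ having $p$ and $q$ leaves respectively).
   Formalization: In (iii) both p and n-3-p are taken to be at least 2; for n-3-p=1 the tree is T(1,n-4), already treated in (ii), and (iii) as stated can fail there (e.g. n=9, k=0, p=5, where R=10 rather than 9). *)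

(* Defs.v *)
From mathcomp Require Import all_boot.

Set Implicit Arguments.
Unset Strict Implicit.
Unset Printing Implicit Defensive.

Record sgraph := SGraph {
  vertex :> finType;
  edge : rel vertex;
  edge_sym : symmetric edge;
  edge_irr : irreflexive edge }.

Arguments edge {s} x y.

Definition degree (G : sgraph) (x : G) : nat := #|[set y | edge x y]|.

Definition max_degree (G : sgraph) : nat := \max_(x : G) degree x.

Definition connected (G : sgraph) : Prop :=
  0 < #|G| /\ forall x y : G, connect edge x y.

(* [ucycle] also accepts sequences of length at most 2 (an edge traversed back
   and forth), which are not cycles of a graph. *)
Definition acyclic (G : sgraph) : Prop :=
  ~ exists s : seq G, 2 < size s /\ ucycle edge s.

Definition is_tree (G : sgraph) : Prop := connected G /\ acyclic G.

Definition isomorphic (G H : sgraph) : Prop :=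
  exists2 f : G -> H, bijective f & forall x y : G, edge (f x) (f y) = edge x y.

(* Not necessarily induced. *)
Definition contains_copy (H G : sgraph) : Prop :=
  exists2 f : G -> H, injective f & forall x y : G, edge x y -> edge (f x) (f y).

Section ColourClass.
Variables (N : nat) (c : {set 'I_N} -> bool) (b : bool).

Definition colour_edge : rel 'I_N :=
  fun x y => (x != y) && (c [set x; y] == b).

Lemma colour_edge_sym : symmetric colour_edge.
Proof. by move=> x y; rewrite /colour_edge eq_sym setUC. Qed.

Lemma colour_edge_irr : irreflexive colour_edge.
Proof. by move=> x; rewrite /colour_edge eqxx. Qed.

Definition colour_class : sgraph := SGraph colour_edge_sym colour_edge_irr.

End ColourClass.

(* The edges of K_N are the two-element subsets of 'I_N; a colouring [c] is only
   ever evaluated on those. [true] is red and [false] is blue. *)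
Definition ramsey_property (G H : sgraph) (N : nat) : Prop :=
  forall c : {set 'I_N} -> bool,
    contains_copy (colour_class c true) G \/
    contains_copy (colour_class c false) H.

(* R(G, H) = N *)
Definition is_ramsey_number (G H : sgraph) (N : nat) : Prop :=
  ramsey_property G H N /\ forall M, ramsey_property G H M -> N <= M.

Section Star.
Variable m : nat.

(* The centre is [ord0]. *)
Definition star_edge : rel 'I_m.+1 :=
  fun x y => (x == ord0) (+) (y == ord0).

Lemma star_edge_sym : symmetric star_edge.
Proof. by move=> x y; rewrite /star_edge addbC. Qed.

Lemma star_edge_irr : irreflexive star_edge.
Proof. by move=> x; rewrite /star_edge addbb. Qed.

(* K_{1,m} *)
Definition star : sgraph := SGraph star_edge_sym star_edge_irr.

End Star.

Section DoubleBroom.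
Variables p q : nat.

(* [inl 0], [inl 1], [inl 2] are v_2, v_3, v_4; [inr (inl _)] are the p leaves
   at v_2 and [inr (inr _)] the q leaves at v_4. *)
Definition T_vertex : finType := ('I_3 + ('I_p + 'I_q))%type.

Definition T_arc (x y : T_vertex) : bool :=
  match x, y with
  | inl i, inl j => j == i.+1 :> nat
  | inl i, inr (inl _) => i == 0 :> nat
  | inl i, inr (inr _) => i == 2 :> nat
  | _, _ => false
  end.

Definition T_edge : rel T_vertex := fun x y => T_arc x y || T_arc y x.

Lemma T_edge_sym : symmetric T_edge.
Proof. by move=> x y; rewrite /T_edge orbC. Qed.

Lemma T_edge_irr : irreflexive T_edge.
Proof. by move=> [i|x]; rewrite /T_edge //= orbb ltn_eqF. Qed.

(* T(p, q) *)
Definition T_graph : sgraph := SGraph T_edge_sym T_edge_irr.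

End DoubleBroom.

Definition linear_combination (ps : seq nat) (N : nat) : Prop :=
  exists k : 'I_(size ps) -> nat, N = \sum_(i < size ps) k i * nth 0 ps i.

(* Main.v *)
Require Import Defs.
From mathcomp Require Import all_boot perm zify.

Set Implicit Arguments.
Unset Strict Implicit.
Unset Printing Implicit Defensive.

(* Put d = n - 3.  A colouring of K_N without a blue K_{1,m} is a red graph of
   minimum degree at least N - m, so for N = m + n - 3 the question is which
   connected graphs G with at least d + 3 vertices and minimum degree at least d
   avoid T; components with d + 1 or d + 2 vertices avoid T for trivial reasons,
   and since k <= n - 5 they cannot cover all m + n - 3 vertices on their own.

   Let a and b be two leaves of the tree of non-leaves of T, and let the core C
   be T without the p leaves at a and the q leaves at b.  As |C| = d + 3 - p - q,
   every partial embedding of a connected part of C extends greedily to C, and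
   by Hall's condition for two sets it extends to T if the image of a misses two
   vertices of the image of C.  Hence if G avoids T, vertices at distance 2 are
   twins of degree d, and G is complete multipartite; it then has three pairwise
   non-adjacent twins, which suffices to embed every core except the path a c b,
   that is, every T except T(p, q).  Double stars, where C = {a, b}, are embedded
   around an edge whose endpoints have many neighbours in total.

   For T = T(p, q) the complete multipartite graphs that remain are those with
   parts of size a >= 3 dividing d if p = 1, and only K_{d,d} if p, q >= 2. *)

(** * Connected vertex sets *)

Definition nb (G : sgraph) (x : G) : {set G} := [set y | edge x y].

(** Connectedness by cuts: a set [B] separating two vertices of [A] is crossed by an edge inside
    [A]. Growing [A] or pruning leaves then only means moving the cut. *)
Definition conn (G : sgraph) (A : {set G}) : Prop :=
  forall (B : {set G}) u v, u \in A -> v \in A -> u \in B -> v \notin B ->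
  exists x y, [/\ x \in A, y \in A, x \in B, y \notin B & edge x y].

Section Graph.
Variable G : sgraph.
Implicit Types (A B : {set G}) (x y u v : G).

Lemma edgeC x y : edge x y = edge y x. Proof. exact: edge_sym. Qed.
Lemma edgexx x : edge x x = false. Proof. exact: edge_irr. Qed.

Lemma edge_neq x y : edge x y -> x != y.
Proof. by apply: contraTneq => ->; rewrite edgexx. Qed.

Lemma closed_stays (P : G -> Prop) u v :
  (forall x y, P x -> edge x y -> P y) -> P u -> connect edge u v -> P v.
Proof.
move=> Pcl Pu /connectP[p pp ->]; elim: p u Pu pp => //= y p IHp u Pu /andP[uy].
by apply: IHp; apply: Pcl uy.
Qed.

Lemma conn_setT : connected G -> conn [set: G].
Proof.
move=> [_ Gc] B u v _ _ uB vB.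
case: (pickP [pred z : G * G | [&& z.1 \in B, z.2 \notin B & edge z.1 z.2]]).
  by move=> [x y] /and3P[? ? ?]; exists x, y; rewrite !inE.
move=> none; case/negP: vB; apply: (@closed_stays (fun z => z \in B) u v _ uB (Gc u v)).
move=> x y xB xy; apply/negPn/negP => yB.
by have := none (x, y); rewrite /= xB yB xy.
Qed.

Lemma conn1 x : conn [set x].
Proof. by move=> B u v /set1P-> /set1P-> ->. Qed.

Lemma conn_add A u v : conn A -> u \in A -> edge u v -> conn (v |: A).
Proof.
move=> cA uA uv B x y xA yA xB yB.
have cv z : (z \in B) != (v \in B) -> z \in A ->
  exists x y, [/\ x \in v |: A, y \in v |: A, x \in B, y \notin B & edge x y].
  move=> zv zA; case: (boolP (u \in B)) => uB; case: (boolP (v \in B)) => vB.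
  - have zB : z \notin B by move: zv; rewrite vB; case: (z \in B).
    have [s [t [sA tA sB tB st]]] := cA B u z uA zA uB zB.
    by exists s, t; split=> //; rewrite in_setU ?sA ?tA orbT.
  - by exists u, v; split=> //; rewrite !inE ?uA ?eqxx ?orbT.
  - by exists v, u; split; rewrite // ?inE ?uA ?eqxx ?orbT // edgeC.
  - have zB : z \in B by move: zv; rewrite (negPf vB); case: (z \in B).
    have [s [t [sA tA sB tB st]]] := cA B z u zA uA zB uB.
    by exists s, t; split=> //; rewrite in_setU ?sA ?tA orbT.
move: xA yA; rewrite !in_setU1 => /predU1P[xv|xA] /predU1P[yv|yA].
- by move: yB; rewrite yv -xv xB.
- by apply: (cv y) => //; rewrite -xv xB (negPf yB).
- by apply: (cv x) => //; rewrite -yv xB (negPf yB).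
have [s [t [sA tA sB tB st]]] := cA B x y xA yA xB yB.
by exists s, t; split=> //; rewrite in_setU ?sA ?tA orbT.
Qed.

(** A cut of [A] extends to the whole graph: a leaf outside [A] joins the side of [B] if its
    neighbour lies in [A :&: B]. An edge crossing the extended cut then has both ends in [A]. *)
Lemma conn_del_leaves A : conn [set: G] -> (forall x, x \notin A -> degree x = 1) ->
  conn A.
Proof.
move=> cG leaf B u v uA vA uB vB.
pose B' := [set x | (x \in A) && (x \in B) || (x \notin A) && [exists y in A :&: B, edge x y]].
have uB' : u \in B' by rewrite inE uA uB.
have vB' : v \notin B' by rewrite inE vA (negPf vB).
have [x [y [_ _ xB yB xy]]] := cG B' u v (in_setT _) (in_setT _) uB' vB'.
move: xB; rewrite inE => /orP[/andP[xA xB]|/andP[xA /existsP[z /andP[/setIP[zA zB] xz]]]].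
  case: (boolP (y \in A)) => yA; last first.
    case/negP: yB; rewrite inE (negPf yA) /=; apply/existsP; exists x.
    by rewrite inE xA xB edgeC.
  by exists x, y; split=> //; move: yB; rewrite inE yA; case: (y \in B).
have /eqP/cards1P[w nw] : #|nb x| = 1 by apply: leaf.
have : z \in nb x by rewrite inE.
have : y \in nb x by rewrite inE.
rewrite nw => /set1P yw /set1P zw; case/negP: yB.
by rewrite yw -zw inE zA zB.
Qed.

(** A path inside [A] between two such neighbours would close up to a cycle through [v]. *)
Lemma acyclic_unique_nb A v u u' : acyclic G -> conn A -> v \notin A ->
  u \in A -> u' \in A -> edge v u -> edge v u' -> u = u'.
Proof.
move=> acG cA vA uA u'A vu vu'; apply/eqP/negPn/negP => uu'.
pose R := [rel x y : G | [&& x \in A, y \in A & edge x y]].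
have /connectP[p pp pl] : connect R u u'.
  apply/negPn/negP => nc; have := cA [set x | connect R u x] u u' uA u'A.
  rewrite !inE connect0 => /(_ isT nc)[x [y [xA yA]]]; rewrite !inE => ux uy xy.
  by case/negP: uy; apply: connect_trans ux (connect1 _); rewrite /= xA yA.
case/shortenP: pp pl => q qp uq _ ql; apply: acG; exists (v :: u :: q).
have qA : all (mem A) q.
  elim: q {uq ql} u {vu uu' uA} qp => //= y q IHq x /andP[/and3P[_ yA _] /IHq->].
  by rewrite yA.
split; first by case: q ql {qp uq qA} => //= ql; rewrite ql eqxx in uu'.
rewrite /ucycle /= vu rcons_path /= -ql edgeC vu' andbT -/(uniq (u :: q)) uq.
rewrite inE negb_or (memPnC vA) // andbT /=; apply/andP; split.
  by apply: sub_path qp => x y /and3P[].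
by apply: contra vA => /(allP qA).
Qed.

(* The leaf is the last vertex added when [A] is grown from [r]. *)
Lemma conn_leaf A r : acyclic G -> conn A -> r \in A -> 1 < #|A| ->
  exists a c, [/\ a \in A, a != r & nb a :&: A = [set c]].
Proof.
move=> acG cA rA A1.
suff IH k B : #|A| - #|B| = k -> r \in B -> conn B -> B \proper A ->
    exists a c, [/\ a \in A, a != r & nb a :&: A = [set c]].
  apply: (IH _ [set r]) => //; first by rewrite inE.
    exact: conn1.
  rewrite properEcard sub1set rA /=; by rewrite cards1.
elim: k B => [|k IHk] B cB rB conB /properP[sBA [w wA wB]].
  by have : #|B| < #|A| by [apply/proper_card/properP; split=> //; exists w]; lia.
have [x [y [xA yA xB yB xy]]] := cA B r w rA wA rB wB.
case: (eqVneq (y |: B) A) => [Adef|neq]; last first.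
  have pBA : y |: B \proper A by rewrite properEneq neq subUset sub1set yA.
  apply: (IHk _ _ _ (conn_add conB xB xy) pBA); last by rewrite in_setU rB orbT.
  by rewrite cardsU1 yB; lia.
exists y, x; split=> //; first by apply: contraNneq yB => ->.
apply/setP => z; rewrite -Adef !inE; apply/andP/eqP => [[yz]|->]; last first.
  by rewrite edgeC xy xB orbT.
case/orP => [/eqP zy|zB]; first by rewrite zy edgexx in yz.
by apply: (acyclic_unique_nb acG conB yB) => //; rewrite edgeC.
Qed.

(** [S] consists of [x], its neighbours in [S] and the vertices it misses, so every missed vertex
    buys one more neighbour outside [S]. Later estimates of the room for leaves rest on this
    identity. *)
Lemma card_nbD x (S : {set G}) : x \in S ->
  #|nb x :\: S| + #|S| = degree x + 1 + #|S :\: (x |: nb x)|.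
Proof.
move=> xS.
rewrite -[degree x](cardsID S (nb x)) -(cardsID (x |: nb x) S).
rewrite setIUr cardsU; have -> : S :&: [set x] = [set x].
  by apply/setIidPr; rewrite sub1set.
have -> : [set x] :&: (S :&: nb x) = set0.
  by apply/setP => y; rewrite !inE; case: eqP => // ->; rewrite edgexx andbF.
rewrite cards0 cards1 setIC /nb; lia.
Qed.

End Graph.

(** * Partial embeddings *)

(** [f] is total, but its values off [A] are ignored, so [A] can grow without changing the type of
    [f]. *)
Definition emb (T G : sgraph) (A : {set T}) (f : T -> G) : Prop :=
  {in A &, injective f} /\ {in A &, forall u v, edge u v -> edge (f u) (f v)}.

Lemma subset_of_card (X : finType) (A : {set X}) k : k <= #|A| ->
  exists2 B : {set X}, B \subset A & #|B| = k.
Proof.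
case/card_geqP => s [us ss sA]; exists [set x in s].
  by apply/subsetP => x; rewrite inE; apply: sA.
by rewrite cardsE (card_uniqP us).
Qed.

(** [P] takes vertices of [A :\: B] first and draws on [A :&: B] only for the deficit, which leaves
    as much of [B] as possible. *)
Lemma hall_pair (X : finType) (A B : {set X}) p q :
  p <= #|A| -> q <= #|B| -> p + q <= #|A :|: B| ->
  exists P Q : {set X}, [/\ P \subset A, Q \subset B, [disjoint P & Q], #|P| = p & #|Q| = q].
Proof.
move=> pA qB pqAB.
have [P [PA Pp qBP]] : exists P : {set X}, [/\ P \subset A, #|P| = p & q <= #|B :\: P|].
  have [pAB|ABp] := leqP p #|A :\: B|.
    have [P PAB Pp] := subset_of_card pAB; move: (PAB); rewrite subsetD => /andP[PA dPB].
    exists P; split=> //; suff -> : B :\: P = B by [].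
    by apply/setDidPl; rewrite disjoint_sym.
  have ABA : p - #|A :\: B| <= #|A :&: B| by move: (cardsID B A); lia.
  have [P PAB Pp] := subset_of_card ABA.
  have dP : [disjoint A :\: B & P].
    rewrite disjoint_sym; apply: disjointWl PAB _.
    by rewrite -setI_eq0; apply/eqP/setP => x; rewrite !inE; case: (x \in B); rewrite ?andbF.
  have cP : #|(A :\: B) :|: P| = p.
    by move: dP; rewrite -setI_eq0 => /eqP dP; rewrite cardsU dP cards0; lia.
  have PA : (A :\: B) :|: P \subset A.
    by rewrite subUset subsetDl (subset_trans PAB) ?subsetIl.
  exists ((A :\: B) :|: P); split=> //.
  suff -> : B :\: (A :\: B :|: P) = (A :|: B) :\: (A :\: B :|: P).
    rewrite cardsD (setIidPr _) ?cP; first by lia.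
    by apply: subset_trans PA (subsetUl _ _).
  by apply/setP => x; rewrite !inE; case: (x \in A); case: (x \in B); rewrite //= ?andbF ?andbT.
have [Q QB Qq] := subset_of_card qBP; exists P, Q.
by move: QB; rewrite subsetD disjoint_sym => /andP[].
Qed.

Lemma disjoint_setU (X : finType) (A B C : {set X}) :
  [disjoint A :|: B & C] = [disjoint A & C] && [disjoint B & C].
Proof. by rewrite -!setI_eq0 setIUl setU_eq0. Qed.

Section Embedding.
Variables (T G : sgraph) (acT : acyclic T).
Implicit Types (A C : {set T}) (a b u v : T) (f : T -> G) (x y : G).

Lemma emb1 a x : emb [set a] (fun _ => x).
Proof.
by split=> u v /set1P-> /set1P-> //; rewrite edgexx.
Qed.

Lemma emb_sub A C f : A \subset C -> emb C f -> emb A f.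
Proof. by move=> /subsetP sAC [fi fe]; split=> u v /sAC uC /sAC vC; [apply: fi|apply: fe]. Qed.

Lemma emb_setT f : emb [set: T] f -> contains_copy G T.
Proof. by case=> fi fe; exists f => [u v|u v]; [apply: fi|apply: fe]. Qed.

(** As [T] has no cycle, [u] is the only neighbour of [v] in [A], so only one edge has to be
    respected at [x]. *)
Lemma emb_add A f u v x : conn A -> emb A f -> u \in A -> v \notin A -> edge u v ->
  x \notin f @: A -> edge (f u) x ->
  exists g, [/\ emb (v |: A) g, {in A, g =1 f} & g v = x].
Proof.
move=> cA [fi fe] uA vA uv xA ux.
pose g z := if z == v then x else f z.
have gA z : z \in A -> g z = f z by move=> zA; rewrite /g (negPf (memPn vA z zA)).
have gv : g v = x by rewrite /g eqxx.
have nx z : z \in A -> f z <> x by move=> zA zx; case/negP: xA; rewrite -zx imset_f.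
have nbv z : z \in A -> edge v z -> z = u.
  by move=> zA vz; apply: (acyclic_unique_nb acT cA vA) => //; rewrite edgeC.
exists g; split=> //; split=> s t /setU1P[->|sA] /setU1P[->|tA] //; rewrite ?gv ?gA //.
- by move=> E; case: (nx t).
- by move=> E; case: (nx s).
- exact: fi.
- by rewrite edgexx.
- by move=> /nbv-> //; rewrite edgeC.
- by rewrite edgeC => /nbv-> //; rewrite edgeC.
- exact: fe.
Qed.

Lemma emb_card A f : emb A f -> #|f @: A| = #|A|.
Proof. by case=> fi _; rewrite card_in_imset. Qed.

(** Before [A] fills [C] its image has at most [d] vertices, one of them [f u], so [f u] still has a
    neighbour outside the image. *)
Lemma emb_greedy d A C f : (forall x, d <= degree x) -> #|C| <= d.+1 ->
  conn C -> conn A -> A != set0 -> A \subset C -> emb A f ->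
  exists2 g, emb C g & {in A, g =1 f}.
Proof.
move=> degG Cd cC.
have [k] := ubnP (#|C| - #|A|); elim: k A f => // k IHk A f kCA cA A0 AC fA.
case: (boolP (C \subset A)) => [CA|/subsetPn[w wC wA]].
  by exists f => //; apply: emb_sub fA.
case/set0Pn: A0 => r rA.
have [u [v [uC vC uA vA uv]]] := cC A r w (subsetP AC _ rA) wC rA wA.
have AltC : #|A| < #|C| by apply/proper_card/properP; split=> //; exists w.
have [x xu xA] : exists2 x, edge (f u) x & x \notin f @: A.
  have : 0 < #|nb (f u) :\: f @: A|.
    have := card_nbD (imset_f f uA); rewrite (emb_card fA); have := degG (f u).
    lia.
  by case/card_gt0P => x; rewrite !inE => /andP[? ?]; exists x.
have [g [gA' gA _]] := emb_add cA fA uA vA uv xA xu.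
have [||||h hC hA'] := IHk _ _ _ _ _ _ gA'.
- by rewrite cardsU1 vA; lia.
- exact: conn_add cA uA uv.
- by apply/set0Pn; exists v; rewrite setU11.
- by rewrite subUset sub1set vC.
exists h => // z zA; rewrite hA' ?gA //; by rewrite in_setU zA orbT.
Qed.

(** The leaves are placed on [P] one at a time. The bound on the image keeps it away from the
    vertices reserved for a second family of leaves. *)
Lemma emb_leaves A f a (L : {set T}) (P : {set G}) :
  conn A -> a \in A -> emb A f -> L \subset nb a -> [disjoint L & A] ->
  P \subset nb (f a) -> [disjoint P & f @: A] -> #|L| <= #|P| ->
  exists g, [/\ conn (L :|: A), emb (L :|: A) g, {in A, g =1 f} &
    g @: (L :|: A) \subset P :|: f @: A].
Proof.
have [k] := ubnP #|L|; elim: k A f L P => // k IHk A f L P Lk cA aA fA La LA Pa PA LP.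
case: (set_0Vmem L) => [->|[l lL]].
  by exists f; rewrite set0U; split=> //; apply: subsetUr.
have P0 : 0 < #|P| by rewrite (leq_trans _ LP) //; apply/card_gt0P; exists l.
case/card_gt0P: P0 => x xP.
have al : edge a l by have := subsetP La l lL; rewrite inE.
have lA : l \notin A by rewrite (disjointFr LA).
have xA : x \notin f @: A by rewrite (disjointFr PA).
have ax : edge (f a) x by have := subsetP Pa x xP; rewrite inE.
have [g [gA' gA gl]] := emb_add cA fA aA lA al xA ax.
have gim : g @: (l |: A) = x |: f @: A.
  by rewrite imsetU1 gl; congr (_ |: _); apply: eq_in_imset.
have EL : (L :\ l) :|: (l |: A) = L :|: A by rewrite setUA [_ :|: [set l]]setUC setD1K.
have EP : (P :\ x) :|: (x |: f @: A) = P :|: f @: A by rewrite setUA [_ :|: [set x]]setUC setD1K.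
have [|||||||||h [ch hA' hA him]] := IHk (l |: A) g (L :\ l) (P :\ x).
- by move: Lk; rewrite (cardsD1 l L) lL.
- exact: conn_add cA aA al.
- by rewrite in_setU aA orbT.
- exact: gA'.
- by rewrite (subset_trans _ La) ?subsetDl.
- apply/pred0P => z; rewrite /= !inE; case: eqP => //= _.
  by apply/negP => /andP[zL zA]; rewrite (disjointFr LA zL) in zA.
- by rewrite gA // (subset_trans _ Pa) ?subsetDl.
- rewrite gim; apply/pred0P => z; rewrite /= !inE; case: eqP => //= _.
  by apply/negP => /andP[zP zA]; rewrite (disjointFr PA zP) in zA.
- by move: LP; rewrite (cardsD1 l L) lL (cardsD1 x P) xP; lia.
exists h; rewrite -EL; split=> //.
  by move=> z zA; rewrite hA ?gA // in_setU zA orbT.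
by rewrite -EP -gim.
Qed.

(** [hall_pair] reserves disjoint sets of free vertices for the two families of leaves, which are
    then attached one after the other. *)
Lemma emb_finish C (La Lb : {set T}) a b f : conn C -> a \in C -> b \in C -> emb C f ->
  La \subset nb a -> Lb \subset nb b -> [disjoint La & C] -> [disjoint Lb & C] ->
  [disjoint La & Lb] -> C :|: La :|: Lb = [set: T] ->
  #|La| <= #|nb (f a) :\: f @: C| -> #|Lb| <= #|nb (f b) :\: f @: C| ->
  #|La| + #|Lb| <= #|(nb (f a) :\: f @: C) :|: (nb (f b) :\: f @: C)| ->
  contains_copy G T.
Proof.
move=> cC aC bC fC Laa Lbb LaC LbC LaLb CT pX qY pqXY.
have [P [Q [PX QY PQ cP cQ]]] := hall_pair pX qY pqXY.
move: PX QY; rewrite !subsetD => /andP[Pa PC] /andP[Qb QC].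
have [|g [cg gC gf gim]] := emb_leaves cC aC fC Laa LaC Pa PC; first by rewrite cP.
have [|||||h [_ hC _ _]] := @emb_leaves (La :|: C) g b Lb Q cg _ gC Lbb.
- by rewrite in_setU bC orbT.
- by rewrite disjoint_sym disjoint_setU LaLb disjoint_sym.
- by rewrite gf.
- rewrite disjoint_sym; apply: disjointWl gim _; by rewrite disjoint_setU PQ disjoint_sym.
- by rewrite cQ.
apply: (@emb_setT h); rewrite -CT.
by apply: emb_sub hC; rewrite [C :|: La]setUC setUC.
Qed.

End Embedding.

(** * The core of a tree *)

(** [C] arises from [T] by deleting the leaves at [a] and at [b], while leaves elsewhere stay; [c]
    and [c'] are the vertices through which [a] and [b] hang on to the rest of [C]. *)
Record core (T : sgraph) (C : {set T}) (a b c c' : T) : Prop := Core {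
  core_conn : conn C;
  core_a : a \in C;
  core_b : b \in C;
  core_neq : a != b;
  core_nba : nb a :&: C = [set c];
  core_nbb : nb b :&: C = [set c'];
  core_leaf : forall x, x \notin C -> degree x = 1;
  core_cover : C :|: nb a :|: nb b = [set: T];
  core_La : 0 < #|nb a :\: C|;
  core_Lb : 0 < #|nb b :\: C| }.

Definition miss (G : sgraph) (x : G) (S : {set G}) : {set G} := S :\: (x |: nb x).

Section Core.
Variables (T : sgraph) (C : {set T}) (a b c c' : T).
Hypothesis hC : core C a b c c'.

Lemma core_sym : core C b a c' c.
Proof.
case: hC => *; split=> //; first by rewrite eq_sym.
by rewrite -setUA [nb b :|: _]setUC setUA.
Qed.

Lemma core_leaf_nb x y z : x \notin C -> edge x y -> edge x z -> y = z.
Proof.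
move=> /(core_leaf hC) /eqP/cards1P[w nx] xy xz.
by apply: etrans (_ : _ = w) _; [|symmetry]; apply/set1P; rewrite -nx inE.
Qed.

Lemma core_c : c \in C /\ edge a c.
Proof. by have : c \in nb a :&: C by [rewrite (core_nba hC) inE]; rewrite !inE => /andP[]. Qed.

Lemma core_c_unique x : x \in C -> edge a x -> x = c.
Proof. by move=> xC ax; apply/set1P; rewrite -(core_nba hC) !inE ax. Qed.

Lemma core_leaves_disjoint : [disjoint nb a :\: C & nb b :\: C].
Proof.
apply/pred0P => x; rewrite /= !inE; apply/negP => /andP[/andP[xC ax] /andP[_ bx]].
case/negP: (core_neq hC); apply/eqP; apply: (core_leaf_nb xC); by rewrite edgeC.
Qed.

Lemma core_cover' : C :|: (nb a :\: C) :|: (nb b :\: C) = [set: T].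
Proof.
rewrite -(core_cover hC); apply/setP => x; rewrite !inE.
by case: (x \in C).
Qed.

Lemma core_card : #|C| + #|nb a :\: C| + #|nb b :\: C| = #|T|.
Proof.
rewrite -cardsT -core_cover' -setUA !cardsU; have := core_leaves_disjoint.
rewrite -setI_eq0 => /eqP->; rewrite cards0.
suff -> : C :&: (nb a :\: C :|: nb b :\: C) = set0 by rewrite cards0; lia.
by apply/setP => x; rewrite !inE; case: (x \in C).
Qed.

Variables (G : sgraph) (acT : acyclic T) (d : nat).
Hypotheses (cardT : #|T| = d + 3) (degG : forall x : G, d <= degree x).
Implicit Type f : T -> G.

Lemma core_finish f : emb C f ->
  #|nb a :\: C| <= #|nb (f a) :\: f @: C| -> #|nb b :\: C| <= #|nb (f b) :\: f @: C| ->
  #|nb a :\: C| + #|nb b :\: C| <= #|(nb (f a) :\: f @: C) :|: (nb (f b) :\: f @: C)| ->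
  contains_copy G T.
Proof.
have dC z : [disjoint nb z :\: C & C].
  by rewrite -setI_eq0; apply/eqP/setP => x; rewrite !inE; case: (x \in C); rewrite ?andbF.
move=> fC; apply: (emb_finish acT (core_conn hC) (core_a hC) (core_b hC) fC) => //.
- exact: subsetDl.
- exact: subsetDl.
- exact: core_leaves_disjoint.
- exact: core_cover'.
Qed.

Lemma card_nb_image f u : emb C f -> u \in C ->
  #|nb (f u) :\: f @: C| + #|C| = degree (f u) + 1 + #|miss (f u) (f @: C)|.
Proof. by move=> fC uC; rewrite -[#|C|](emb_card fC) card_nbD ?imset_f. Qed.

Lemma miss_nonadj f u v : emb C f -> u \in C -> v \in C -> u != v ->
  ~~ edge (f u) (f v) -> f v \in miss (f u) (f @: C).
Proof.
move=> [fi _] uC vC uv nuv; rewrite !inE imset_f // andbT negb_or nuv andbT.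
by apply: contra uv => /eqP/fi->.
Qed.

Lemma core_greedy A f : conn A -> A != set0 -> A \subset C -> emb A f ->
  exists2 g, emb C g & {in A, g =1 f}.
Proof.
apply: emb_greedy degG _ (core_conn hC) => //.
(* Both families of leaves are nonempty, hence [#|C| <= d + 1]. *)
have := core_card; have := core_La hC; have := core_Lb hC; lia.
Qed.

(** The images of [b] and [u] are exchanged. That of [b] is joined to the whole image of the core,
    so it can replace that of [u]; conversely [b] has the single core neighbour [c'], and the last
    hypothesis takes care of that edge. *)
Lemma emb_swap f u : emb C f -> u \in C -> u != b ->
  miss (f b) (f @: C) = set0 -> (u == c') || edge (f c') (f u) ->
  exists g, [/\ emb C g, g @: C = f @: C, g b = f u &
    forall v, v != b -> v != u -> g v = f v].
Proof.
move=> [fi fe] uC ub mb cu; pose g := f \o tperm b u.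
have bC := core_b hC.
have tC z : z \in C -> tperm b u z \in C by move=> zC; case: tpermP => // ->.
have bx z : z \in C -> z != b -> edge (f b) (f z).
  move=> zC zb; move/setP: mb => /(_ (f z)); rewrite !inE imset_f // andbT.
  move/negbFE; rewrite orbC; case/orP => // /eqP /fi E.
  by rewrite E ?eqxx // in zb.
have ebC z : z \in C -> edge b z -> z = c'.
  by move=> zC bz; apply/set1P; rewrite -(core_nbb hC) !inE bz.
have c'C : c' \in C.
  by have := set11 c'; rewrite -(core_nbb hC) inE => /andP[].
have bc' : edge b c'.
  by have := set11 c'; rewrite -(core_nbb hC) !inE => /andP[].
have eg v w : v \in C -> w \in C -> v != w -> w != b -> edge v w -> edge (g v) (g w).
  move=> vC wC vw wb vwE; rewrite /g /=; case: (tpermP b u v) => [vb|vu|vb vu].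
  - have wc : w = c' by apply: ebC => //; rewrite -vb.
    rewrite {}wc in vw wb vwE *; case: (tpermP b u c') => [E|E|_ /eqP E].
    + by rewrite E eqxx in wb.
    + by rewrite edgeC bx.
    + by move: cu; rewrite eq_sym (negPf E) edgeC.
  - by rewrite tpermD ?bx // 1?eq_sym // -vu eq_sym.
  - case: tpermP => [/eqP|wu|_ _]; first by rewrite (negPf wb).
      by rewrite edgeC bx //; apply/eqP.
    exact: fe.
exists g; split=> //.
- split=> v w vC wC; first by move/fi => /(_ (tC _ vC) (tC _ wC)) /perm_inj.
  move=> vw; have nvw := edge_neq vw.
  case: (eqVneq w b) => [wb|wb]; last exact: eg.
  by rewrite edgeC; apply: (eg w v wC vC); rewrite -?wb // ?(eq_sym w) // edgeC.
- rewrite /g imset_comp; suff -> : tperm b u @: C = C by []; apply/setP => z.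
  apply/imsetP/idP => [[y yC ->]|zC]; first exact: tC.
  by exists (tperm b u z); rewrite ?tpermK ?tC.
- by rewrite /g /= tpermL.
- by move=> v vb vu; rewrite /g /= tpermD // eq_sym.
Qed.

(* The image of [a] leaves enough room for all the remaining leaves; if the image
   of [b] lacks one vertex for its own leaves, it is joined to the whole core and
   can be exchanged with the image of a vertex that misses some core vertex. *)
Lemma core_key f : c' != a -> emb C f -> 0 < #|miss (f a) (f @: C)| ->
  d + 2 <= degree (f a) + #|miss (f a) (f @: C)| -> contains_copy G T.
Proof.
move=> c'a fC ma0 ma; have aC := core_a hC; have bC := core_b hC; have ab := core_neq hC.
have cT := core_card; have pa := core_La hC; have qb := core_Lb hC.
suff [g [gC gim ga mb]] : exists g, [/\ emb C g, g @: C = f @: C, g a = f a &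
    d + 1 <= degree (g b) + #|miss (g b) (g @: C)|].
  have Ea := card_nb_image gC aC; have Eb := card_nb_image gC bC.
  rewrite -gim -ga in ma.
  have sU := subset_leq_card (subsetUl (nb (g a) :\: g @: C) (nb (g b) :\: g @: C)).
  by apply: (core_finish gC); lia.
have [mb|mb] := leqP (d + 1) (degree (f b) + #|miss (f b) (f @: C)|); first by exists f.
have mb0 : miss (f b) (f @: C) = set0 by apply/eqP; rewrite -cards_eq0; have := degG (f b); lia.
have c'C : c' \in C by have := set11 c'; rewrite -(core_nbb hC) inE => /andP[].
have c'b : c' != b.
  have : edge b c' by have := set11 c'; rewrite -(core_nbb hC) !inE => /andP[].
  by move/edge_neq; rewrite eq_sym.
(* [u] is [c'] if its image misses something. Otherwise the image of [c'] is joined to the rest of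
   the core, and any vertex missed by the image of [a] will do. *)
have [u [uC ua ub mu cu]] : exists u, [/\ u \in C, u != a, u != b,
    0 < #|miss (f u) (f @: C)| & (u == c') || edge (f c') (f u)].
  have [mc|mc] := posnP #|miss (f c') (f @: C)|; last by exists c'; rewrite eqxx.
  case/card_gt0P: ma0 => y; rewrite !inE => /andP[yN /imsetP[u uC yu]].
  move: yN; rewrite {}yu negb_or => /andP[ua nau].
  have nua : u != a by apply: contraNneq ua => ->.
  have joined v w : v \in C -> w \in C -> v != w -> ~~ edge (f v) (f w) ->
      0 < #|miss (f v) (f @: C)|.
    by move=> vC wC vw nvw; apply/card_gt0P; exists (f w); apply: miss_nonadj.
  exists u; split=> //.
  - apply: contraNneq nau => ->; rewrite edgeC; apply/negPn/negP => nab.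
    have : 0 < #|miss (f b) (f @: C)| by apply: (joined b a) => //; rewrite eq_sym.
    by rewrite mb0 cards0.
  - by apply: (joined u a) => //; rewrite edgeC.
  - case: (eqVneq u c') => //= uc'; apply/negPn/negP => ncu.
    have : 0 < #|miss (f c') (f @: C)| by apply: (joined c' u) => //; rewrite eq_sym.
    by rewrite mc.
have [g [gC gim gb gv]] := emb_swap fC uC ub mb0 cu.
exists g; split=> //; first by apply: gv; rewrite // eq_sym.
by rewrite gb gim; have := degG (f u); lia.
Qed.

End Core.

(** * Graphs avoiding a tree *)

(* A complete multipartite graph all of whose non-trivial parts have
   vertices of degree [d]. *)
Definition multipartite (d : nat) (G : sgraph) : Prop :=
  forall x z : G, x != z -> ~~ edge x z -> nb x = nb z /\ degree x = d.

(** A search over finitely many maps; it permits arguing by contradiction about copies. *)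
Lemma contains_copy_dec (G T : sgraph) : decidable (contains_copy G T).
Proof.
pose P (f : {ffun T -> G}) :=
  injectiveb f && [forall x, forall y, edge x y ==> edge (f x) (f y)].
case: (boolP [exists f, P f]) => [/existsP ex|nex]; [left|right].
  have [f /andP[/injectiveP fi /forallP fe]] := ex; exists f => // x y.
  by move/(implyP (forallP (fe x) y)).
case=> f fi fe; case/existsP: nex; exists (finfun f); apply/andP; split.
  by apply/injectiveP => x y; rewrite !ffunE; apply: fi.
by apply/forallP => x; apply/forallP => y; apply/implyP; rewrite !ffunE; apply: fe.
Qed.

Lemma complete_contains_copy (G T : sgraph) :
  (forall x z : G, x != z -> edge x z) -> #|T| <= #|G| -> contains_copy G T.
Proof.
move=> cG TG; pose f (t : T) : G := enum_val (widen_ord TG (enum_rank t)).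
have fi : injective f.
  move=> s t /enum_val_inj /(congr1 val) /= E; apply: enum_rank_inj; exact: val_inj.
exists f => // s t st; apply: cG; apply: contraTneq (edge_neq st) => /fi->.
by rewrite eqxx.
Qed.

(** No vertex is at distance 3 from [x], since a neighbour of a vertex at distance 2 is already a
    neighbour of [x]. By connectedness distinct non-adjacent vertices are at distance 2, and
    exchanging them turns the inclusion into an equality. *)
Lemma multipartite_of_twins (d : nat) (G : sgraph) : connected G ->
  (forall x y z : G, edge x y -> edge y z -> x != z -> ~~ edge x z ->
     degree x = d /\ nb z \subset nb x) ->
  multipartite d G.
Proof.
move=> [_ cG] tw x z xz nxz.
pose P w := [\/ w = x, edge x w | exists2 y, edge x y & edge y w].
have /(_ z) : forall z, P z.
  move=> w; apply: (@closed_stays G P x w _ _ (cG x w)); last by constructor.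
  move=> u v [->|xu|[y xy yu]] uv; first by constructor 2.
    by constructor 3; exists u.
  case: (eqVneq u x) => [E|ux]; first by constructor 2; rewrite -E.
  case: (boolP (edge x u)) => [xu|nxu]; first by constructor 3; exists u.
  rewrite eq_sym in ux; have [_ /subsetP/(_ v)] := tw _ _ _ xy yu ux nxu.
  by rewrite !inE => /(_ uv) xv; constructor 2.
case=> [E|xz'|[y xy yz]]; first by rewrite E eqxx in xz.
  by rewrite xz' in nxz.
have [dx zx] := tw _ _ _ xy yz xz nxz; split=> //; apply/eqP.
rewrite eqEsubset zx andbT; apply: (proj2 (tw z y x _ _ _ _)); rewrite 1?edgeC //.
by rewrite eq_sym.
Qed.

Section Multipartite.
Variables (d : nat) (G : sgraph).
Hypotheses (mG : multipartite d G) (cardG : d + 3 <= #|G|).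

Lemma multipartite_nonadj (x z : G) : ~~ edge x z -> nb x = nb z.
Proof. by case: (eqVneq x z) => [->|xz /mG[]]. Qed.

(** [x] has only [d] neighbours among at least [d + 3] vertices, so a third non-neighbour is left
    besides [x] and [x1]. *)
Lemma multipartite_part (x x1 : G) : x != x1 -> ~~ edge x x1 ->
  exists x2, [/\ x2 != x, x2 != x1, nb x1 = nb x & nb x2 = nb x].
Proof.
move=> xx1 nxx1; have [N1 dx] := mG xx1 nxx1.
have : 0 < #|~: (x1 |: (x |: nb x))|.
  rewrite cardsCs setCK !cardsU1.
  move: dx cardG; rewrite /degree -/(nb x); lia.
case/card_gt0P => x2; rewrite !inE !negb_or => /and3P[x21 x2x nx2].
by exists x2; split; rewrite // (multipartite_nonadj nx2).
Qed.

End Multipartite.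

(** * Trees that are not double stars *)

Section CoreContains.
Variables (T G : sgraph) (acT : acyclic T) (d : nat) (C : {set T}) (a b c c' : T).
Hypotheses (hC : core C a b c c') (cb : c != b).
Hypotheses (cardT : #|T| = d + 3) (degG : forall x : G, d <= degree x).
Hypotheses (coG : connected G) (cardG : d + 3 <= #|G|).
Hypothesis noT : ~ contains_copy G T.
Implicit Types (f : T -> G) (u v : T) (x y z : G).

(** The partial embeddings from which the greedy extension to the core can start. *)
Definition pemb (A : {set T}) (f : T -> G) : Prop :=
  [/\ conn A, A != set0, A \subset C & emb A f].

Lemma pemb_add A f u v x : pemb A f -> u \in A -> v \in C -> v \notin A ->
  edge u v -> x \notin f @: A -> edge (f u) x ->
  exists g, [/\ pemb (v |: A) g, {in A, g =1 f} & g v = x].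
Proof.
case=> cA A0 AC fA uA vC vA uv xA ux.
have [g [gA gf gv]] := emb_add acT cA fA uA vA uv xA ux.
exists g; split=> //; split=> //; first exact: conn_add cA uA uv.
  by apply/set0Pn; exists v; rewrite setU11.
by rewrite subUset sub1set vC.
Qed.

Lemma pemb_ext A f : pemb A f -> exists2 g, emb C g & {in A, g =1 f}.
Proof. by case=> cA A0 AC fA; apply: (core_greedy hC acT cardT degG). Qed.

Lemma core_aC : a \in C. Proof. exact: core_a hC. Qed.
Lemma core_bC : b \in C. Proof. exact: core_b hC. Qed.
Lemma core_cC : c \in C. Proof. by case: (core_c hC). Qed.
Lemma core_ac : edge a c. Proof. by case: (core_c hC). Qed.
Lemma core_ac_neq : a != c. Proof. exact: edge_neq core_ac. Qed.

Lemma core_c'a : c' != a.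
Proof.
apply: contraNneq cb => c'a; have [_] := core_c (core_sym hC).
by rewrite c'a edgeC => /(core_c_unique hC core_bC)->.
Qed.

Lemma pemb_path e x y z : e \in C -> edge c e -> e != a ->
  edge x y -> edge y z -> x != z ->
  exists f, [/\ pemb [set e; c; a] f, f a = x, f c = y & f e = z].
Proof.
move=> eC ce ea xy yz xz.
have p1 : pemb [set a] (fun=> x).
  split; [exact: conn1| |by rewrite sub1set core_aC|exact: emb1].
  by apply/set0Pn; exists a; rewrite inE.
have [||||||f [pf fa fc]] := pemb_add (u := a) (v := c) (x := y) p1.
- by rewrite inE.
- exact: core_cC.
- by rewrite inE eq_sym core_ac_neq.
- exact: core_ac.
- by apply/imsetP => -[s _ E]; rewrite E edgexx in xy.
- by [].
have aca : a \in [set a] by rewrite inE.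
have Efa : f a = x by rewrite fa.
have [||||||g [pg ga gc]] := pemb_add (u := c) (v := e) (x := z) pf.
- by rewrite !inE eqxx.
- exact: eC.
- by rewrite !inE negb_or ea eq_sym (edge_neq ce).
- exact: ce.
- rewrite imsetU1 imset_set1 fc Efa !inE negb_or eq_sym (edge_neq yz) /=.
  by rewrite eq_sym.
- by rewrite fc.
exists g; rewrite -setUA; split=> //.
  by rewrite ga ?Efa // !inE eqxx orbT.
by rewrite ga ?fc // !inE eqxx.
Qed.

(** Contrapositive of [core_key]. As degrees are at least [d], the image of [a] misses at most one
    vertex of the core, and has degree exactly [d] if it misses one. *)
Lemma no_slack f : emb C f -> 0 < #|miss (f a) (f @: C)| ->
  degree (f a) + #|miss (f a) (f @: C)| <= d + 1.
Proof.
move=> fC ma; rewrite leqNgt; apply/negP => H; apply: noT.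
apply: (core_key hC acT cardT degG core_c'a fC ma); move: H; clear; lia.
Qed.

Lemma miss2 f u v x : emb C f -> u \in C -> v \in C -> f u != f v -> f a = x ->
  x != f u -> x != f v -> ~~ edge x (f u) -> ~~ edge x (f v) -> False.
Proof.
move=> fC uC vC uv fa xu xv nu nv.
have E : 1 < #|miss (f a) (f @: C)|.
  apply/card_gt1P; exists (f u), (f v); split=> //.
    by rewrite !inE fa negb_or eq_sym xu nu imset_f.
  by rewrite !inE fa negb_or eq_sym xv nv imset_f.
move: E (no_slack fC (ltnW E)) (degG (f a)); clear; lia.
Qed.

(** For a core with a path [a c e g]. With [a], [c], [e] on [x], [y], [z], the vertex [x] misses
    [z], whence its degree is [d]. A neighbour of [z] not adjacent to [x] could host [g], and [x]
    would miss two vertices. *)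
Lemma twins_path e g : e \in C -> g \in C -> edge c e -> e != a -> edge e g ->
  g != c -> forall x y z : G, edge x y -> edge y z -> x != z -> ~~ edge x z ->
     degree x = d /\ nb z \subset nb x.
Proof.
move=> eC gC ce ea eg gc x y z xy yz xz nxz.
have [f [pf fa fc fe]] := pemb_path eC ce ea xy yz xz; split.
  have [h hC' hf] := pemb_ext pf.
  have ha : h a = x by rewrite hf // !inE eqxx !orbT.
  have he : h e = z by rewrite hf // !inE eqxx.
  have mz : 0 < #|miss (h a) (h @: C)|.
    have zS : z \in h @: C by rewrite -he imset_f.
    by apply/card_gt0P; exists z; rewrite !inE zS ha negb_or nxz eq_sym xz.
  by move: mz (no_slack hC' mz) (degG x); rewrite ha; clear; lia.
apply/subsetP => w; rewrite !inE => zw; apply/negPn/negP => nxw.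
have ga : g != a.
  apply: contraTneq ce => ga; rewrite ga edgeC in eg.
  by rewrite (core_c_unique hC eC eg) edgexx.
have [||||||h [ph hf hg]] := pemb_add (u := e) (v := g) (x := w) pf.
- by rewrite !inE eqxx.
- exact: gC.
- by rewrite !inE !negb_or eq_sym (edge_neq eg) gc.
- exact: eg.
- rewrite !imsetU !imset_set1 fa fc fe !inE !negb_or eq_sym (edge_neq zw) /=.
  apply/andP; split; first by apply: contraNneq nxw => ->.
  by apply: contraNneq nxz => <-; rewrite edgeC.
- by rewrite fe.
have [k kC kh] := pemb_ext ph.
have kg : k g = w by rewrite kh ?hg // setU11.
have ke : k e = z by rewrite kh ?hf ?fe // !inE eqxx ?orbT.
have ka : k a = x by rewrite kh ?hf ?fa // !inE eqxx ?orbT.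
apply: (miss2 kC eC gC _ ka); rewrite ?ke ?kg //; first exact: edge_neq.
by apply: contraNneq nxz => ->; rewrite edgeC.
Qed.

(** With [a], [c], [b] on [x], [y], [z], the free neighbours of [x] are one vertex short of the
    total number of leaves. A free neighbour of [z] not adjacent to [x] would supply it and complete
    a copy of [T]. *)
Lemma twins_star : edge c b ->
  forall x y z : G, edge x y -> edge y z -> x != z -> ~~ edge x z ->
     degree x = d /\ nb z \subset nb x.
Proof.
move=> cb' x y z xy yz xz nxz; have ab := core_neq hC; have ba : b != a by rewrite eq_sym.
have [f0 [pf f0a _ f0b]] := pemb_path core_bC cb' ba xy yz xz.
have [f fC ff] := pemb_ext pf.
have fa : f a = x by rewrite ff // !inE eqxx ?orbT.
have fb : f b = z by rewrite ff // !inE eqxx ?orbT.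
have ma : z \in miss (f a) (f @: C).
  by rewrite -fb; apply: (miss_nonadj fC core_aC core_bC ab); rewrite fa fb.
have mb : x \in miss (f b) (f @: C).
  by rewrite -fa; apply: (miss_nonadj fC core_bC core_aC ba); rewrite fa fb edgeC.
have ma0 : 0 < #|miss (f a) (f @: C)| by apply/card_gt0P; exists z.
have mb0 : 0 < #|miss (f b) (f @: C)| by apply/card_gt0P; exists x.
have ns := no_slack fC ma0; have da := degG (f a); have db := degG (f b).
split; first by move: ns da ma0; rewrite fa; clear; lia.
(* [x] misses [z] alone, which settles the neighbours of [z] inside the image. *)
have ma1 : miss (f a) (f @: C) = [set z].
  by apply/eqP; rewrite eq_sym eqEcard sub1set ma cards1; move: ns da; clear; lia.
have Ea := card_nb_image fC core_aC; have Eb := card_nb_image fC core_bC.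
have cT := core_card hC; have pa := core_La hC; have qb := core_Lb hC.
set X := nb (f a) :\: f @: C in Ea; set Y := nb (f b) :\: f @: C in Eb.
have YX : Y \subset X.
  apply/negPn/negP => /subsetPn[w wY wX]; apply: noT.
  have : #|w |: X| <= #|X :|: Y|.
    by apply: subset_leq_card; rewrite subUset sub1set inE wY orbT subsetUl.
  rewrite cardsU1 wX => XY.
  have [pX qY] : #|nb a :\: C| <= #|X| /\ #|nb b :\: C| <= #|Y|.
    move: Ea Eb cT pa qb ma0 mb0 da db; rewrite cardT.
    by move: #|X| #|Y| #|C| => nX nY nC; clear; lia.
  apply: (core_finish hC acT fC) => //; apply: leq_trans XY.
  by move: Ea cT qb ma0 da; rewrite cardT; move: #|X| #|C| => nX nC; clear; lia.
apply/subsetP => w; rewrite !inE => zw.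
case: (boolP (w \in f @: C)) => wS; last first.
  have : w \in X by apply: (subsetP YX); rewrite !inE wS fb.
  by rewrite !inE fa => /andP[].
apply/negPn/negP => nxw; move/setP: ma1 => /(_ w); rewrite !inE wS fa (negPf nxw).
rewrite orbF andbT (eq_sym w z) (negPf (edge_neq zw)) => /negbFE/eqP wx.
by rewrite wx edgeC (negPf nxz) in zw.
Qed.

Lemma no_copy_multipartite : multipartite d G.
Proof.
case: (boolP (edge c b)) => [cb'|ncb].
  exact: multipartite_of_twins coG (twins_star cb').
(* An edge leaving the closed neighbourhood of [c] yields the path [a c e g]. *)
have [||e [g [eC gC]]] :=
  core_conn hC (B := [set v | (v == c) || edge c v]) core_cC core_bC.
- by rewrite inE eqxx.
- by rewrite inE negb_or eq_sym cb.
rewrite !inE negb_or => ce /andP[gc ncg] eg.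
have {}ce : edge c e.
  by case/orP: ce => // /eqP E; rewrite E (negPf ncg) in eg.
have ea : e != a.
  by apply: contraNneq gc => E; rewrite E in eg; rewrite (core_c_unique hC gC eg).
exact: multipartite_of_twins coG (twins_path eC gC ce ea eg gc).
Qed.

Lemma miss_twins f u v x x1 x2 : emb C f -> u \in C -> v \in C ->
  f a = x -> f u = x1 -> f v = x2 -> x1 != x -> x2 != x -> x2 != x1 ->
  nb x1 = nb x -> nb x2 = nb x -> False.
Proof.
move=> fC uC vC fa fu fv x1x x2x x21 N1 N2.
have nadj y : nb y = nb x -> ~~ edge x y.
  by move=> Ny; have /setP/(_ x) := Ny; rewrite !inE edgexx edgeC => ->.
apply: (miss2 fC uC vC _ fa); rewrite ?fu ?fv //; rewrite 1?eq_sym //; exact: nadj.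
Qed.

(** A non-complete [G] has a part with three vertices [x], [x1], [x2]. For most shapes of [C], [a]
    and two more core vertices can be placed on them, against [miss_twins]; for [a c e b] with
    possible leaves at [e], [x2] stays free and helps in the count for Hall's condition. *)
Lemma no_copy_core : C = [set a; c; b].
Proof.
have mG := no_copy_multipartite.
have [[x x1] /= /andP[xx1 nxx1]|complete] :=
    pickP [pred z : G * G | (z.1 != z.2) && ~~ edge z.1 z.2]; last first.
  case: noT; apply: complete_contains_copy; last by rewrite cardT.
  by move=> x z xz; apply/negPn/negP => nxz; have := complete (x, z); rewrite /= xz nxz.
have [x2 [x2x x21 N1 N2]] := multipartite_part mG cardG xx1 nxx1.
have [_ degx] := mG _ _ xx1 nxx1.
have x1x : x1 != x by rewrite eq_sym.
have twin := miss_twins _ _ _ _ _ _ x1x x2x x21 N1 N2.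
have nbE (w u : G) : nb w = nb x -> edge w u = edge x u.
  by move=> /setP/(_ u); rewrite !inE.
have d2 : 1 < d.
  have C3 : 2 < #|C|.
    apply/card_gt2P; exists a, c, b; split; first by rewrite core_aC core_cC core_bC.
    by rewrite core_ac_neq cb eq_sym (core_neq hC).
  move: (core_card hC) (core_La hC) (core_Lb hC) C3 cardT; clear; lia.
(* [y] and [y'] host the vertices between those placed in the part. The last alternative serves the
   case where [y] hosts [b] and needs one extra free neighbour: if the neighbours of [x] form a
   clique, [y] is adjacent to every other vertex. *)
have [y [y' [xy xy' yy' ymiss]]] : exists y y', [/\ edge x y, edge x y', y != y' &
    ~~ edge y y' || (d < degree y)].
  have [[y y'] /= /and4P[? ? ? nyy']|clique] := pickP [pred z : G * G |
      [&& edge x z.1, edge x z.2, z.1 != z.2 & ~~ edge z.1 z.2]].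
    by exists y, y'; rewrite nyy'.
  have /card_gt1P[y [y' []]] : 1 < #|nb x| by rewrite -/(degree x) degx.
  rewrite !inE => xy xy' yy'; exists y, y'; split=> //; apply/orP; right.
  have : [set: G] :\ y \subset nb y.
    apply/subsetP => w; rewrite !inE andbT => wy; apply/negPn/negP => nyw.
    have yw : y != w by rewrite eq_sym.
    have [Nyw _] := mG _ _ yw nyw.
    have xw : edge x w by move/setP/(_ x): Nyw; rewrite !inE ![edge _ x]edgeC xy.
    by have := clique (y, w); rewrite /= xy xw yw nyw.
  move/subset_leq_card; have := cardsT G.
  by rewrite (cardsD1 y) in_setT /degree -/(nb y); move: cardG; clear; lia.

have leave (A : {set T}) e g : A \subset C -> e \in A -> g \in C -> g \notin A ->
    exists u v, [/\ u \in A, v \in C, v \notin A & edge u v].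
  move=> AC eA gC gA.
  by have [u [v [_ vC uA vA uv]]] := core_conn hC (subsetP AC e eA) gC eA gA; exists u, v.
have acC : [set a; c] \subset C by rewrite subUset !sub1set core_aC core_cC.
have a_ac : a \in [set a; c] by rewrite !inE eqxx.
have b_ac : b \notin [set a; c].
  by rewrite !inE negb_or eq_sym (core_neq hC) eq_sym cb.
have [c1 [e [cac eC eac c1e]]] := leave _ _ _ acC a_ac core_bC b_ac.
move: eac cac c1e; rewrite !inE negb_or => /andP[ea ec] /orP[] /eqP-> ce.
  by rewrite (core_c_unique hC eC ce) eqxx in ec.
(* If [c] has two neighbours [e], [t] in [C] besides [a], then [a], [e], [t] go
   to a single part. *)
have [t /and4P[tC ct ta te]|tri] :=
    pickP [pred t | [&& t \in C, edge c t, t != a & t != e]].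
  have [f [pf fa fc fe]] := pemb_path eC ce ea xy (etrans (edgeC _ _) (etrans (nbE _ _ N1) xy)) xx1.
  have [||||||h [ph hf ht]] := pemb_add (u := c) (v := t) (x := x2) pf.
  - by rewrite !inE eqxx orbT.
  - exact: tC.
  - by rewrite !inE !negb_or te ta eq_sym (edge_neq ct).
  - exact: ct.
  - rewrite !imsetU !imset_set1 fa fc fe !inE !negb_or x21 x2x andbT /=.
    by apply: contraTneq xy => <-; rewrite -(nbE _ _ N2) edgexx.
  - by rewrite fc edgeC (nbE _ _ N2).
  have [k kC kh] := pemb_ext ph.
  case: (twin k e t kC eC tC).
  - by rewrite kh ?hf ?fa // !inE eqxx ?orbT.
  - by rewrite kh ?hf ?fe // !inE eqxx ?orbT.
  - by rewrite kh ?ht // !inE eqxx.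

have ac_c : c \in [set a; c] by rewrite !inE eqxx orbT.
(* If [C] has a path [a c e s g], then [a], [e], [g] go to a single part. *)
have [[s g] /= /and5P[sC gC es sg /andP[sc ge]]|nopath] :=
    pickP [pred z : T * T | [&& z.1 \in C, z.2 \in C, edge e z.1, edge z.1 z.2 &
      (z.1 != c) && (z.2 != e)]].
  have [f [pf fa fc fe]] := pemb_path eC ce ea xy' (etrans (edgeC _ _) (etrans (nbE _ _ N1) xy')) xx1.
  have sa : s != a.
    apply: contraTneq es => E; rewrite edgeC E; apply/negP => /(core_c_unique hC eC).
    by move=> ec'; rewrite ec' edgexx in ce.
  have x1y : edge x1 y by rewrite (nbE _ _ N1).
  have [||||||h [ph hf hs]] := pemb_add (u := e) (v := s) (x := y) pf.
  - by rewrite !inE eqxx.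
  - exact: sC.
  - by rewrite !inE !negb_or sa sc eq_sym (edge_neq es).
  - exact: es.
  - rewrite !imsetU !imset_set1 fa fc fe !inE !negb_or yy' eq_sym (edge_neq x1y) /=.
    by rewrite eq_sym (edge_neq xy).
  - by rewrite fe.
  have ga : g != a.
    apply: contraTneq sg => E; rewrite edgeC E; apply/negP => /(core_c_unique hC sC).
    by move=> sc'; rewrite sc' eqxx in sc.
  have gc : g != c.
    apply: contraTneq sg => E; rewrite edgeC E; apply/negP => cs.
    by have := tri s; rewrite /= sC cs sa eq_sym (edge_neq es).
  have x2y : edge x2 y by rewrite (nbE _ _ N2).
  have x2y' : edge x2 y' by rewrite (nbE _ _ N2).
  have [||||||h' [ph' hf' hg]] := pemb_add (u := s) (v := g) (x := x2) ph.
  - by rewrite !inE eqxx.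
  - exact: gC.
  - by rewrite !inE !negb_or ga gc ge eq_sym (edge_neq sg).
  - exact: sg.
  - rewrite imsetU1 hs.
    have -> : h @: [set e; c; a] = f @: [set e; c; a] by apply: eq_in_imset.
    rewrite !imsetU !imset_set1 fa fc fe !inE !negb_or x21 x2x.
    by rewrite (edge_neq x2y) (edge_neq x2y').
  - by rewrite hs edgeC.
  have [k kC kh] := pemb_ext ph'.
  case: (twin k e g kC eC gC).
  - by rewrite kh ?hf' ?hf ?fa // !inE eqxx ?orbT.
  - by rewrite kh ?hf' ?hf ?fe // !inE eqxx ?orbT.
  - by rewrite kh ?hg // !inE eqxx.
(* Otherwise [C] is [a c b], or [a c e b] with further leaves at [e]. *)
have near v : v \in C -> [|| v == a, v == c, v == e | edge e v].
  move=> vC; apply/negPn/negP => nv; pose B := [set w in C | [|| w == a, w == c, w == e | edge e w]].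
  have aB : a \in B by rewrite !inE eqxx core_aC.
  have vB : v \notin B by rewrite inE vC.
  have [u [w [uC wC uB wB uw]]] := core_conn hC core_aC vC aB vB.
  move: wB; rewrite !inE wC /= !negb_or => /and4P[wa wc we new].
  move: uB; rewrite !inE uC /= => /or4P[/eqP E|/eqP E|/eqP E|eu].
  - by rewrite E in uw; rewrite (core_c_unique hC wC uw) eqxx in wc.
  - by have := tri w; rewrite /= wC -E uw wa we.
  - by rewrite -E uw in new.
  - have := nopath (u, w); rewrite /= uC wC eu uw we andbT /= => /negbFE/eqP E.
    by have := tri w; rewrite /= wC -E uw wa we.
have /or4P[/eqP E|/eqP E|/eqP E|eb] := near b core_bC.
- by have := core_neq hC; rewrite E eqxx.
- by move: (cb); rewrite E eqxx.
- apply/setP => v; rewrite !inE E; apply/idP/idP => [vC|].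
    have /or4P[->|->|->|ev] := near v vC; rewrite ?orbT //.
    have := core_c_unique (core_sym hC) vC; rewrite E => /(_ ev) ->.
    have := core_c_unique (core_sym hC) core_cC; rewrite E edgeC => /(_ ce) ->.
    by rewrite eqxx orbT.
  by case/orP => [/orP[]|] /eqP->; [exact: core_aC|exact: core_cC|].
exfalso; have x1y : edge x1 y by rewrite (nbE _ _ N1).
have [f [pf fa fc fe]] := pemb_path eC ce ea xy' (etrans (edgeC _ _) (etrans (nbE _ _ N1) xy')) xx1.
have [||||||h [ph hf hb]] := pemb_add (u := e) (v := b) (x := y) pf.
- by rewrite !inE eqxx.
- exact: core_bC.
- by rewrite !inE !negb_or eq_sym (edge_neq eb) eq_sym cb eq_sym (core_neq hC).
- exact: eb.
- rewrite !imsetU !imset_set1 fa fc fe !inE !negb_or yy' eq_sym (edge_neq x1y) /=.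
  by rewrite eq_sym (edge_neq xy).
- by rewrite fe.
have [k kC kh] := pemb_ext ph.
have ka : k a = x by rewrite kh ?hf ?fa // !inE eqxx ?orbT.
have kc : k c = y' by rewrite kh ?hf ?fc // !inE eqxx ?orbT.
have ke : k e = x1 by rewrite kh ?hf ?fe // !inE eqxx ?orbT.
have kb : k b = y by rewrite kh ?hb // !inE eqxx.
(* If [x2] were used, three core vertices, [a] among them, would lie in one part. *)
have x2S : x2 \notin k @: C.
  by apply/negP => /imsetP[t tC kt]; apply: (twin k e t kC eC tC).
have ma : 0 < #|miss (k a) (k @: C)|.
  by apply/card_gt0P; exists (k e); apply: miss_nonadj; rewrite ?core_aC // ?ka ?ke // eq_sym.
have mb : d < degree (k b) + #|miss (k b) (k @: C)|.
  case/orP: ymiss => [nyy'|dy]; last by rewrite kb ltn_addr.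
  suff mb : 0 < #|miss (k b) (k @: C)| by have := degG (k b); move: mb; clear; lia.
  apply/card_gt0P; exists (k c); apply: miss_nonadj; rewrite ?core_cC ?core_bC ?kb ?kc //.
  by rewrite eq_sym.
have Ea := card_nb_image kC core_aC; have Eb := card_nb_image kC core_bC.
have cT := core_card hC; have pa := core_La hC; have qb := core_Lb hC.
rewrite cardT in cT; have da := degG (k a).
(* [x2] is adjacent to the image of [b] but not to that of [a], which supplies the one vertex still
   lacking. *)
have XY : #|nb (k a) :\: k @: C| < #|(nb (k a) :\: k @: C) :|: (nb (k b) :\: k @: C)|.
  have nx2 : x2 \notin nb (k a) :\: k @: C.
    by rewrite !inE ka -(nbE _ _ N2) edgexx andbF.
  have := cardsU1 x2 (nb (k a) :\: k @: C); rewrite nx2 add1n => <-.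
  apply: subset_leq_card; rewrite subUset sub1set subsetUl andbT !inE kb x2S /=.
  by rewrite (edgeC y) (nbE _ _ N2) xy orbT.
apply: noT; apply: (core_finish hC acT kC); last (apply: leq_trans XY).
- by move: Ea cT qb ma da; move: #|C| => nC; clear; lia.
- by move: Eb cT pa mb; move: #|C| => nC; clear; lia.
- by move: Ea cT ma da; move: #|C| => nC; clear; lia.
Qed.

End CoreContains.

(** * Cores of trees and double stars *)

(** The non-leaves form a connected set [W], with at least two vertices because the degree bound
    rules out a star. Two leaves of the tree on [W] serve as [a] and [b], and [C] drops exactly the
    leaves of [T] adjacent to one of them. *)
Lemma tree_core (T : sgraph) d : is_tree T -> #|T| = d + 3 -> max_degree T <= d ->
  exists C a b c c', @core T C a b c c'.
Proof.
move=> [coT acT] cardT maxT; have cT := conn_setT coT.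
have degT (x : T) : 0 < degree x.
  have [y yx] : exists y, y \notin [set x].
    apply/existsP; rewrite -negb_forall; apply/negP => /forallP xT.
    have : #|T| <= #|[set x]| by apply/subset_leq_card/subsetP => z _; apply: xT.
    by rewrite cards1 cardT; clear; lia.
  have [u [v [_ _ /set1P-> _ xv]]] := cT [set x] x y (in_setT _) (in_setT _) (set11 _) yx.
  by apply/card_gt0P; exists v; rewrite inE.
pose W := [set x : T | 1 < degree x].
have leafW x : x \notin W -> degree x = 1.
  by rewrite inE; move: (degT x); clear; lia.
have cW : conn W by apply: conn_del_leaves.
have W2 : 1 < #|W|.
  rewrite ltnNge; apply/negP => W1.
  have [r Wr] : exists r, W \subset [set r].
    have [/eqP|/card_gt0P[r rW]] := posnP #|W|.
      rewrite cards_eq0 => /eqP->; have : 0 < #|T| by rewrite cardT addn3.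
      by case/card_gt0P => r _; exists r; apply: sub0set.
    exists r; have : [set r] == W by rewrite eqEcard sub1set rW cards1.
    by move/eqP <-.
  have star v : v \in r |: nb r.
    apply/negPn/negP => vr.
    have [x [y [_ _ xB yB xy]]] := cT _ _ _ (in_setT r) (in_setT v) (setU11 r _) vr.
    move: yB; rewrite !inE negb_or => /andP[yr ry]; move: xB; rewrite !inE.
    case: (eqVneq x r) => [E|xr] /= => [_|rx]; first by rewrite -E xy in ry.
    have /leafW/eqP/cards1P[w nx] : x \notin W.
      by apply: contraNN xr => /(subsetP Wr); rewrite inE.
    have : y \in nb x by rewrite inE.
    have : r \in nb x by rewrite inE edgeC.
    by rewrite /nb nx !inE => /eqP rw /eqP yw; rewrite yw -rw eqxx in yr.
  have : #|T| <= #|r |: nb r| by apply/subset_leq_card/subsetP => v _.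
  have : degree r <= d by apply: leq_trans maxT; apply: (leq_bigmax r).
  rewrite cardsU1 cardT /degree -/(nb r); case: (_ \notin _); clear; lia.
have [r rW] : exists r, r \in W by apply/card_gt0P; apply: ltnW.
have [a [c [aW _ ac]]] := conn_leaf acT cW rW W2.
have [b [c' [bW ba bc]]] := conn_leaf acT cW aW W2.
have NW x y : nb x :&: W = [set y] -> x \in W -> 0 < #|nb x :\: W|.
  move=> E; rewrite inE -[degree x](cardsID W (nb x)) E cards1; clear; lia.
pose C := ~: ((nb a :|: nb b) :\: W).
have WC x : x \in W -> x \in C by rewrite /C !inE => ->.
have leafC x : x \notin C -> x \notin W by apply: contraNN; apply: WC.
have nC z : z \in C -> (z \in nb a) || (z \in nb b) -> z \in W.
  by rewrite /C in_setC in_setD in_setU negb_and negbK => /orP[->//|/negPf->].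
exists C, a, b, c, c'; split.
- by apply: conn_del_leaves => // x /leafC/leafW.
- exact: WC.
- exact: WC.
- by rewrite eq_sym.
- rewrite -ac; apply/setP => z; rewrite !(in_setI _ (nb a)).
  by case za: (z \in nb a) => //=; apply/idP/idP => [/nC->|/WC]; rewrite ?za.
- rewrite -bc; apply/setP => z; rewrite !(in_setI _ (nb b)).
  by case za: (z \in nb b) => //=; apply/idP/idP => [/nC->|/WC]; rewrite ?za ?orbT.
- by move=> x /leafC/leafW.
- apply/setP => z; rewrite !in_setU in_setT -orbA -in_setU /C in_setC in_setD.
  by case: (z \in nb a :|: nb b); rewrite ?orbT ?andbF.
- apply: leq_trans (NW _ _ ac aW) _; apply/subset_leq_card/subsetP => z.
  by rewrite !in_setD => /andP[zW za]; rewrite za andbT; apply: contraNN zW => /nC->; rewrite ?za.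
- apply: leq_trans (NW _ _ bc bW) _; apply/subset_leq_card/subsetP => z.
  by rewrite !in_setD => /andP[zW zb]; rewrite zb andbT; apply: contraNN zW => /nC->; rewrite ?zb ?orbT.
Qed.

Lemma core_double_star (T : sgraph) (C : {set T}) a b c c' : core C a b c c' ->
  c = b -> C = [set a; b].
Proof.
move=> hC cb; have [_] := core_c hC; rewrite cb => ab.
have aC := core_a hC; have bC := core_b hC.
have nbb v : v \in C -> edge b v -> v = a.
  move=> vC bv; rewrite (core_c_unique (core_sym hC) vC bv); symmetry.
  by apply: (core_c_unique (core_sym hC) aC); rewrite edgeC.
apply/eqP; rewrite eqEsubset subUset !sub1set aC bC !andbT.
apply/subsetP => v vC; apply/negPn/negP => vB.
have [|x [y [xC yC xB yB xy]]] := core_conn hC aC vC _ vB; first by rewrite !inE eqxx.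
move: xB yB xy; rewrite !inE negb_or => /orP[] /eqP-> /andP[ya yb] xy.
  by rewrite (core_c_unique hC yC xy) cb eqxx in yb.
by rewrite (nbb y yC xy) eqxx in ya.
Qed.

(** Suppose every edge fails. Then on a path [x y z] with [z] outside the closed neighbourhood of
    [x], [z] is the only neighbour of [y] outside it. Following this along [x y z w s] produces
    either a closed set of at most [d + 2] vertices or a vertex of degree at most 2. *)
Lemma edge_expand (G : sgraph) d : connected G -> (forall x : G, d <= degree x) ->
  2 < d -> d + 3 <= #|G| -> exists x y : G, edge x y /\ d + 3 <= #|nb x :|: nb y|.
Proof.
move=> coG degG d2 cardG.
have [[x y] /= /andP[xy xyd]|none] := pickP [pred z : G * G |
    edge z.1 z.2 && (d + 3 <= #|nb z.1 :|: nb z.2|)]; first by exists x, y.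
have small (x y : G) : edge x y -> #|nb x :|: nb y| < d + 3.
  by move=> xy; have := none (x, y); rewrite /= xy /= ltnNge => ->.
exfalso; have cG := conn_setT coG.
have ballU (x y : G) : edge x y -> x |: nb x \subset nb x :|: nb y.
  by move=> xy; rewrite subUset sub1set subsetUl andbT !inE (edgeC y) xy orbT.
have card_ball (x : G) : #|x |: nb x| = (degree x).+1.
  by rewrite cardsU1 !inE edgexx.
have closed_ball (K : {set G}) r : r \in K -> (forall x y, x \in K -> edge x y -> y \in K) ->
    #|K| = #|G|.
  move=> rK clK; rewrite -cardsT; suff -> : K = [set: G] by []; apply/setP => v; rewrite inE.
  apply/negPn/negP => vK.
  have [x [y [_ _ xK yK xy]]] := cG K r v (in_setT _) (in_setT _) rK vK.
  by rewrite (clK _ _ xK xy) in yK.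
(* The closed neighbourhood of [x] together with [z] already exhausts the [d + 2] vertices that the
   union may have. *)
have outside (x y z : G) : edge x y -> edge y z -> z \notin x |: nb x ->
    degree x = d /\ nb y \subset z |: (x |: nb x).
  move=> xy yz zx; have sm := small _ _ xy; have dx := degG x; have cb := card_ball x.
  have zU : z |: (x |: nb x) \subset nb x :|: nb y.
    by rewrite subUset ballU // sub1set !inE yz orbT.
  have cz : #|z |: (x |: nb x)| = (degree x).+2 by rewrite cardsU1 zx cb.
  have dxd : degree x = d.
    by move: (subset_leq_card zU) sm dx; rewrite cz; clear; lia.
  split=> //; apply/subsetP => w wy; apply/negPn/negP => wK.
  have wU : w |: (z |: (x |: nb x)) \subset nb x :|: nb y.
    by rewrite subUset zU sub1set in_setU wy orbT.
  move: (subset_leq_card wU) sm; rewrite cardsU1 wK cz dxd; clear; lia.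
have reg (x : G) : degree x = d.
  have [v vx] : exists v, v \notin x |: nb x.
    apply/existsP; rewrite -negb_forall; apply/negP => /forallP xT.
    have /card_gt0P[y xy] : 0 < #|nb x| by rewrite -/(degree x); move: (degG x) d2; clear; lia.
    rewrite inE in xy.
    have : #|G| <= #|x |: nb x| by apply/subset_leq_card/subsetP => z _; apply: xT.
    move: (small _ _ xy) (subset_leq_card (ballU _ _ xy)) cardG; clear; lia.
  have [y [z [_ _ yB zB yz]]] := cG _ _ _ (in_setT x) (in_setT v) (setU11 x _) vx.
  move: yB; rewrite !inE; case/predU1P => [E|xy]; last by case: (outside _ _ _ xy yz zB).
  by move: zB; rewrite !inE -E yz orbT.
have /card_gt0P[x _] : 0 < #|G| by move: cardG; clear; lia.
have [v vx] : exists v, v \notin x |: nb x.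
  apply/existsP; rewrite -negb_forall; apply/negP => /forallP xT.
  have : #|G| <= #|x |: nb x| by apply/subset_leq_card/subsetP => z _; apply: xT.
  by rewrite card_ball reg; move: cardG; clear; lia.
have [y [z [_ _ yB zB yz]]] := cG _ _ _ (in_setT x) (in_setT v) (setU11 x _) vx.
have xy : edge x y.
  by move: yB; rewrite !inE => /predU1P[E|//]; move: zB; rewrite !inE -E yz orbT.
have [_ ny] := outside _ _ _ xy yz zB.
have [zx nxz] : z != x /\ ~~ edge x z by move: zB; rewrite !inE negb_or => /andP[].
(* [y] is adjacent to [x], [z] and [M] only; the same [M] will recur in the neighbourhood of [z]. *)
pose M := nb x :&: nb y.
have cM : #|M| = d - 2.
  have : nb y = x |: (z |: M).
    apply/setP => w; rewrite !inE; apply/idP/idP => [yw|].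
      by move: (subsetP ny w); rewrite !inE yw => /(_ isT)/or3P[]->; rewrite ?orbT.
    by case/or3P => [/eqP->|/eqP->|/andP[]] //; rewrite edgeC.
  move/(congr1 (fun A : {set G} => #|A|)); rewrite -/(degree y) reg !cardsU1 !inE.
  rewrite edgexx (negPf nxz) eq_sym (negPf zx) /=; clear; lia.
have yM : y \notin M by rewrite !inE edgexx andbF.
have zy : edge z y by rewrite edgeC.
have xNz : x \notin nb z by rewrite inE edgeC.
have yx : edge y x by rewrite edgeC.
have [w zw wy] : exists2 w, edge z w & w \notin y |: nb y.
  have : ~~ (nb z \subset y |: M).
    apply/negP => /subset_leq_card; rewrite -/(degree z) reg cardsU1 yM cM.
    by move: d2; clear; lia.
  case/subsetPn => w zw wM; rewrite inE in zw; exists w => //.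
  apply: contra wM; rewrite !inE => /predU1P[->|yw]; first by rewrite eqxx.
  rewrite yw andbT; move: (subsetP ny w); rewrite !inE yw => /(_ isT)/or3P[/eqP E|/eqP E|->].
  - by rewrite E edgexx in zw.
  - by rewrite -E inE zw in xNz.
  - by rewrite orbT.
have [_ nz] := outside _ _ _ yz zw wy.
have nzE : nb z = w |: (y |: M).
  apply/eqP; rewrite eqEcard; apply/andP; split.
    apply/subsetP => t; rewrite !inE => zt.
    move: (subsetP nz t); rewrite !inE zt => /(_ isT)/or3P[->//|->|yt]; rewrite ?orbT //.
    move: (subsetP ny t); rewrite !inE yt => /(_ isT)/or3P[/eqP E|/eqP E|->]; rewrite ?orbT //.
      by rewrite E edgexx in zt.
    by rewrite -E inE zt in xNz.
  rewrite -/(degree z) reg !cardsU1 cM; move: d2; do 2!case: (_ \notin _); clear; lia.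
have nbM m : m \in M -> edge z m /\ nb m \subset z |: (x |: nb x).
  move=> mM; have zm : edge z m by have : m \in nb z by [rewrite nzE !in_setU1 mM !orbT]; rewrite inE.
  split=> //; move: mM; rewrite !inE => /andP[xm _].
  by case: (outside x m z xm _ zB) => //; rewrite edgeC.
have wM : w \notin M by apply: contra wy; rewrite !inE => /andP[_ ->]; rewrite orbT.
have wy' : w != y by apply: contraNneq wy => ->; rewrite !inE eqxx.
(* If [x] is adjacent to [w], then [x] and [z] have the same neighbours, and [z |: (x |: nb x)] is
   closed under adjacency but too small. *)
case: (boolP (edge x w)) => xw.
  have nxE : nb x = w |: (y |: M).
    apply/eqP; rewrite eq_sym eqEcard; apply/andP; split.
      by apply/subsetP => t; rewrite !inE => /or3P[/eqP->|/eqP->|/andP[]].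
    have wyM : w \notin y |: M by rewrite in_setU1 negb_or wy'.
    by rewrite -/(degree x) reg cardsU1 wyM cardsU1 yM cM; move: d2; clear; lia.
  have : #|z |: (x |: nb x)| = #|G|.
    apply: (closed_ball _ x); first by rewrite !inE eqxx orbT.
    move=> s t; rewrite !in_setU1 => /or3P[/eqP->|/eqP->|].
    - by move=> zt; have : t \in nb z by [rewrite inE]; rewrite nzE nxE => ->; rewrite !orbT.
    - by rewrite inE => ->; rewrite !orbT.
    rewrite nxE => /setU1P[->|/setU1P[->|sM]] st; rewrite -nxE -!in_setU1.
    + have [|_ /subsetP] := outside x w z xw _ zB; first by rewrite edgeC.
      by apply; rewrite inE.
    + by apply: (subsetP ny); rewrite inE.
    + by have [_ /subsetP] := nbM _ sM; apply; rewrite inE.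
  rewrite cardsU1 card_ball reg; move: cardG; case: (_ \notin _); clear; lia.
(* Otherwise [w] has a neighbour [s] other than [z] and turns out to have no further ones, against
   [d > 2]. *)
have /subsetPn[s sw sz] : ~~ (nb w \subset [set z]).
  apply/negP => /subset_leq_card; rewrite cards1 -/(degree w) reg; move: d2; clear; lia.
have sB : s \notin z |: nb z.
  move: sw sz; rewrite nzE !in_setU1 in_set1 [s \in nb w]inE => ws sz; rewrite (negPf sz) /= !negb_or.
  apply/and3P; split.
  - by apply: contraTneq ws => ->; rewrite edgexx.
  - by apply: contraNneq wy => E; rewrite !inE edgeC -E ws orbT.
  - apply/negP => sM; have [_ /subsetP/(_ w)] := nbM s sM.
    rewrite !inE edgeC => /(_ ws).
    rewrite (negPf xw) orbF => /orP[/eqP E|/eqP E].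
      by rewrite E edgexx in zw.
    by rewrite inE -E zw in xNz.
rewrite inE in sw; have [_ nw] := outside _ _ _ zw sw sB.
have : nb w \subset [set z; s].
  apply/subsetP => t tw; move: (subsetP nw t tw); rewrite !in_setU1 in_set1.
  case/or3P => [->|->|tz]; rewrite ?orbT //; exfalso.
  move: tw; rewrite inE => wt; move: tz; rewrite nzE => /setU1P[E|/setU1P[E|tM]].
  - by rewrite E edgexx in wt.
  - by case/negP: wy; rewrite !inE edgeC -E wt orbT.
  - have [_ /subsetP/(_ w)] := nbM t tM; rewrite !inE edgeC => /(_ wt).
    rewrite (negPf xw) orbF => /orP[/eqP E|/eqP E]; first by rewrite E edgexx in zw.
    by rewrite inE -E zw in xNz.
move/subset_leq_card; rewrite -/(degree w) reg cards2; move: d2; case: (_ != _); clear; lia.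
Qed.

(** * Double brooms *)

(** The broom is indexed by the sizes of [P] and [Q], so that [enum_val] lists the images of the
    leaves. *)
Definition T_map (G : sgraph) (x y z : G) (P Q : {set G}) (u : T_vertex #|P| #|Q|) : G :=
  match u with
  | inl i => if i == 0 :> nat then x else if i == 1 :> nat then y else z
  | inr (inl i) => enum_val i
  | inr (inr j) => enum_val j
  end.

Section TMap.
Variables (G : sgraph) (x y z : G) (P Q : {set G}).
Hypotheses (xy : edge x y) (yz : edge y z) (xz : x != z).
Hypotheses (Px : P \subset nb x) (Qz : Q \subset nb z) (PQ : [disjoint P & Q]).
Hypotheses (PS : [disjoint P & [set x; y; z]]) (QS : [disjoint Q & [set x; y; z]]).

Let g : T_vertex #|P| #|Q| -> G := @T_map G x y z P Q.

Lemma T_map_inj : injective g.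
Proof.
have xy' := edge_neq xy; have yz' := edge_neq yz.
have SP (v : G) i : v \in [set x; y; z] -> enum_val (A := mem P) i != v.
  by move=> vS; apply: contraTneq vS => <-; rewrite (disjointFr PS) // enum_valP.
have SQ (v : G) i : v \in [set x; y; z] -> enum_val (A := mem Q) i != v.
  by move=> vS; apply: contraTneq vS => <-; rewrite (disjointFr QS) // enum_valP.
have PQ' i j : enum_val (A := mem P) i != enum_val (A := mem Q) j.
  by apply: contraTneq (enum_valP j) => <-; rewrite (disjointFr PQ) // enum_valP.
have inS (i : 'I_3) : g (inl i) \in [set x; y; z].
  by rewrite !inE /=; case: ifP => _; [|case: ifP => _]; rewrite eqxx ?orbT.
have inlI (i j : 'I_3) : g (inl i) = g (inl j) -> i = j.
  move=> E; apply: val_inj; move: i j E => [[|[|[|i]]] hi] [[|[|[|j]]] hj] //= /eqP.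
  - by rewrite (negPf xy').
  - by rewrite (negPf xz).
  - by rewrite eq_sym (negPf xy').
  - by rewrite (negPf yz').
  - by rewrite eq_sym (negPf xz).
  - by rewrite eq_sym (negPf yz').
case=> [i|[i|i]] [j|[j|j]] E.
- by rewrite (inlI _ _ E).
- by have := SP _ j (inS i); rewrite E eqxx.
- by have := SQ _ j (inS i); rewrite E eqxx.
- by have := SP _ i (inS j); rewrite -E eqxx.
- by rewrite (enum_val_inj E).
- by have := PQ' i j; rewrite -[enum_val j]E eqxx.
- by have := SQ _ i (inS j); rewrite -E eqxx.
- by have := PQ' j i; rewrite -[enum_val j]E eqxx.
- by rewrite (enum_val_inj E).
Qed.

Lemma T_map_edge u v : T_edge u v -> edge (g u) (g v).
Proof.
have arc s t : T_arc s t -> edge (g s) (g t).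
  case: s t => [[[|[|[|i]]] hi]|[i|i]] [[[|[|[|j]]] hj]|[j|j]] //= _.
  - by have := subsetP Px _ (enum_valP j); rewrite inE.
  - by have := subsetP Qz _ (enum_valP j); rewrite inE.
by case/orP => /arc //; rewrite edgeC.
Qed.

End TMap.

Lemma T_graph_hall (G : sgraph) p q (x y z : G) : edge x y -> edge y z -> x != z ->
  let S := [set x; y; z] in
  p <= #|nb x :\: S| -> q <= #|nb z :\: S| ->
  p + q <= #|(nb x :\: S) :|: (nb z :\: S)| -> contains_copy G (T_graph p q).
Proof.
move=> xy yz xz S pX qZ pqU; have [P [Q [PX QZ PQ Pp Qq]]] := hall_pair pX qZ pqU.
move: PX QZ; rewrite !subsetD => /andP[Px PS] /andP[Qz QS]; rewrite -Pp -Qq.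
exists (@T_map G x y z P Q); first exact: T_map_inj.
exact: T_map_edge.
Qed.

(** [T_map] is applied inside [T] itself. It is onto by counting, and it reflects edges because the
    deleted leaves have a single neighbour and [a], [b] are not adjacent. *)
Lemma core_T_graph (T : sgraph) (C : {set T}) a b c c' : core C a b c c' ->
  c != b -> C = [set a; c; b] ->
  isomorphic T (T_graph #|nb a :\: C| #|nb b :\: C|).
Proof.
move=> hC cb CE; have [cC ac] := core_c hC; have ab := core_neq hC.
have aC := core_a hC; have bC := core_b hC.
have [c'C bc'] := core_c (core_sym hC).
have c'c : c' = c.
  move: (c'C); rewrite CE !inE => /orP[/orP[]|] /eqP E //.
    by case/negP: (core_c'a hC cb); rewrite E.
  by rewrite E edgexx in bc'.
rewrite c'c in bc'; have cb' : edge c b by rewrite edgeC.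
pose P := nb a :\: C; pose Q := nb b :\: C.
have dS z : [disjoint nb z :\: C & [set a; c; b]].
  by rewrite -CE -setI_eq0; apply/eqP/setP => t; rewrite !inE; case: (t \in C); rewrite ?andbF.
pose g := @T_map T a c b P Q.
have gi : injective g.
  by apply: T_map_inj; rewrite ?dS ?(core_leaves_disjoint hC).
have ge : forall u v, T_edge u v -> edge (g u) (g v).
  by apply: T_map_edge => //; apply: subsetDl.
have Pnb i y : edge (g (inr (inl i))) y -> y = a.
  have := enum_valP i; rewrite !inE => /andP[gC ga] gy.
  by apply: (core_leaf_nb hC gC gy); rewrite edgeC.
have Qnb i y : edge (g (inr (inr i))) y -> y = b.
  have := enum_valP i; rewrite !inE => /andP[gC ga] gy.
  by apply: (core_leaf_nb hC gC gy); rewrite edgeC.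
have ge' u v : edge (g u) (g v) -> T_edge u v.
  have side (s t : T_vertex #|P| #|Q|) : (if s is inr _ then true else false) ->
      edge (g s) (g t) -> T_edge s t.
    case: s => // -[i|i] _ st.
      have E : t = inl ord0 by apply: gi; apply: Pnb st.
      by rewrite E /T_edge /= .
    have E : t = inl (inord 2) by apply: gi; rewrite (Qnb _ _ st) /g /= inordK.
    by rewrite E /T_edge /= inordK.
  case: u => [i|u]; last exact: side.
  case: v => [j|v]; last by move=> uv; rewrite T_edge_sym; apply: side; rewrite // edgeC.
  have nab : edge a b = false.
    by apply/negP => /(core_c_unique hC bC) E; rewrite E eqxx in cb.
  move: i j => [[|[|[|i]]] hi] [[|[|[|j]]] hj] //=; rewrite /g /= ?edgexx ?nab //.
  by rewrite edgeC nab.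
have gb : bijective g.
  apply: inj_card_bij gi _; rewrite -(core_card hC) card_sum card_ord card_sum !card_ord.
  rewrite -addnA leq_add2r CE -setUA !cardsU1 cards1; by do 2!case: (_ \notin _).
have [f gf fg] := gb; exists f; first by exists g.
move=> u v; rewrite -{2}[u]fg -{2}[v]fg; apply/idP/idP; first exact: ge.
exact: ge'.
Qed.

(** If no copy exists, a core with [c != b] makes [T] a double broom. If [c = b], [T] is a double
    star, and its centres go to the edge given by [edge_expand]. *)
Lemma tree_contained (T G : sgraph) d : is_tree T -> #|T| = d + 3 -> max_degree T <= d ->
  (forall p, 1 <= p -> 1 <= d - p -> ~ isomorphic T (T_graph p (d - p))) ->
  connected G -> (forall x : G, d <= degree x) -> d + 3 <= #|G| -> contains_copy G T.
Proof.
move=> tT cardT maxT notTpq coG degG cardG; have [_ acT] := tT.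
have [noT|noT] := contains_copy_dec G T; first by [].
have [C [a [b [c [c' hC]]]]] := tree_core tT cardT maxT.
have cT := core_card hC; have pa := core_La hC; have qb := core_Lb hC.
case: (eqVneq c b) => cb; last first.
  have CE := no_copy_core acT hC cb cardT degG coG cardG noT.
  have C3 : #|C| = 3.
    have ac : edge a c by case: (core_c hC).
    rewrite CE -setUA !cardsU1 cards1 !inE negb_or cb (edge_neq ac).
    by rewrite (core_neq hC).
  have Eq : d - #|nb a :\: C| = #|nb b :\: C|.
    by move: cT; rewrite cardT C3; clear; lia.
  case: (notTpq #|nb a :\: C|); rewrite ?Eq //; exact: core_T_graph hC cb CE.
have CE := core_double_star hC cb.
have C2 : #|C| = 2 by rewrite CE cards2 (core_neq hC).
have degE u w : nb u :&: C = [set w] -> #|nb u :\: C| < d.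
  move=> E; have : degree u <= d by apply: leq_trans maxT; apply: (leq_bigmax u).
  by rewrite /degree -/(nb u) -(cardsID C (nb u)) E cards1.
have pd := degE _ _ (core_nba hC); have qd := degE _ _ (core_nbb hC).
(* There are [d + 1] leaves, at most [d - 1] of them on each side. *)
have d2 : 2 < d by move: cT pd qd; rewrite C2 cardT; clear; lia.
have [x [y [xy xyd]]] := edge_expand coG degG d2 cardG.
have ab : edge a b by case: (core_c hC); rewrite cb.
have aa : a \in [set a] by rewrite inE.
have ba : b \notin [set a] by rewrite inE eq_sym (core_neq hC).
have yx : y \notin (fun=> x) @: [set a].
  by apply/imsetP => -[s _ E]; rewrite E edgexx in xy.
have [f [fab fa fb]] := emb_add acT (@conn1 _ a) (@emb1 T G a x) aa ba ab yx xy.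
have {}fa : f a = x by rewrite fa.
have fC : emb C f by rewrite CE setUC.
have fim : f @: C = [set x; y] by rewrite CE imsetU !imset_set1 fa fb.
have sub (u v : G) : edge u v -> nb u :\: [set u; v] = nb u :\ v.
  by move=> uv; apply/setP => w; rewrite !inE negb_or; case: (eqVneq w u) => [->|]; rewrite ?edgexx ?andbF.
have cD (u v : G) : edge u v -> #|nb u :\: [set u; v]| = (degree u).-1.
  by move=> uv; rewrite sub // /degree -/(nb u) (cardsD1 v (nb u)) inE uv.
apply: (core_finish hC acT fC); rewrite fim ?fa ?fb.
- by rewrite cD //; move: (degG x) pd; clear; lia.
- by rewrite setUC cD 1?edgeC //; move: (degG y) qd; clear; lia.
- rewrite -setDUl (cardsD (nb x :|: nb y)); have -> : (nb x :|: nb y) :&: [set x; y] = [set x; y].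
    by apply/setIidPr; rewrite subUset !sub1set !inE (edgeC y) xy orbT.
  by rewrite cards2 (edge_neq xy); move: xyd cT; rewrite cardT C2; clear; lia.
Qed.

(** * Graphs avoiding a double broom *)

Section NoDoubleBroom.
Variables (G : sgraph) (d p q : nat).
Hypotheses (pqd : p + q = d) (p0 : 0 < p) (q0 : 0 < q).
Hypotheses (coG : connected G) (degG : forall x : G, d <= degree x) (cardG : d + 3 <= #|G|).
Hypothesis noT : ~ contains_copy G (T_graph p q).

Lemma card_triple (x y z : G) : edge x y -> edge y z -> x != z -> #|[set x; y; z]| = 3.
Proof.
by move=> xy yz xz; rewrite -setUA !cardsU1 cards1 !inE negb_or xz !(edge_neq _).
Qed.

(** With the spine on [x], [y], [z], both ends miss each other and so have at least [d - 1] free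
    neighbours, enough for either side alone. Only the union can be too small, which forces it to
    consist of the free neighbours of [x]. *)
Lemma no_broom_multipartite : multipartite d G.
Proof.
apply: multipartite_of_twins coG _ => x y z xy yz xz nxz.
pose S := [set x; y; z]; have cS : #|S| = 3 by apply: card_triple.
have xS : x \in S by rewrite !inE eqxx.
have zS : z \in S by rewrite !inE eqxx orbT.
have Ex := card_nbD xS; have Ez := card_nbD zS.
have mx : 0 < #|S :\: (x |: nb x)|.
  by apply/card_gt0P; exists z; rewrite !inE negb_or nxz eqxx orbT eq_sym xz.
have mz : 0 < #|S :\: (z |: nb z)|.
  by apply/card_gt0P; exists x; rewrite !inE negb_or (edgeC z) nxz eqxx xz.
have dx := degG x; have dz := degG z; rewrite cS in Ex Ez.
have hall : #|(nb x :\: S) :|: (nb z :\: S)| < d.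
  rewrite ltnNge; apply/negP => H; apply: noT.
  apply: (T_graph_hall xy yz xz); rewrite -/S ?pqd //.
    by move: Ex mx dx pqd q0; clear; lia.
  by move: Ez mz dz pqd p0; clear; lia.
have sX := subset_leq_card (subsetUl (nb x :\: S) (nb z :\: S)).
split; first by move: Ex mx dx hall sX; clear; lia.
have EX : nb x :\: S = (nb x :\: S) :|: (nb z :\: S).
  by apply/eqP; rewrite eqEcard subsetUl /=; move: Ex mx dx hall sX; clear; lia.
apply/subsetP => w zw; case: (boolP (w \in S)) => wS.
  move: wS zw; rewrite !inE => /orP[/orP[]|] /eqP->.
  - by rewrite edgeC (negPf nxz).
  - by rewrite xy.
  - by rewrite edgexx.
have : w \in nb x :\: S by rewrite EX in_setU !in_setD wS zw orbT.
by rewrite in_setD => /andP[].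
Qed.

Lemma no_broom_nonadj : exists x z : G, x != z /\ ~~ edge x z.
Proof.
have [[x x1] /= /andP[]|complete] :=
    pickP [pred z : G * G | (z.1 != z.2) && ~~ edge z.1 z.2]; first by exists x, x1.
case: noT; apply: complete_contains_copy.
  by move=> x z xz; apply/negPn/negP => nxz; have := complete (x, z); rewrite /= xz nxz.
rewrite card_sum card_ord card_sum !card_ord; move: cardG pqd; clear; lia.
Qed.

Lemma no_broom_degree : exists x : G, degree x = d.
Proof.
by have [x [z [xz nxz]]] := no_broom_nonadj; exists x; case: (no_broom_multipartite xz nxz).
Qed.

(** A triangle could carry the spine: each end has at least [d - 2] free neighbours, and no vertex
    is missed by both ends, as these lie in different parts. So [G] is triangle-free, and the
    neighbourhoods of two adjacent vertices partition it. *)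
Lemma no_broom_bipartite : 1 < p -> 1 < q -> #|G| = d + d.
Proof.
move=> p1 q1; have mG := no_broom_multipartite; have [x [x1 [xx1 nxx1]]] := no_broom_nonadj.
have [_ degx] := mG _ _ xx1 nxx1.
have nonadj := multipartite_nonadj mG.
have triangle (u v w : G) : edge u v -> edge v w -> edge u w -> False.
  move=> uv vw uw; have uw' := edge_neq uw; apply: noT.
  pose S := [set u; v; w]; have cS : #|S| = 3 by apply: card_triple.
  have uS : u \in S by rewrite !inE eqxx.
  have wS : w \in S by rewrite !inE eqxx orbT.
  have Eu := card_nbD uS; have Ew := card_nbD wS; rewrite cS in Eu Ew.
  apply: (T_graph_hall uv vw uw'); rewrite -/S.
  - by move: Eu (degG u) q1 pqd; clear; lia.
  - by move: Ew (degG w) p1 pqd; clear; lia.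
  - have -> : (nb u :\: S) :|: (nb w :\: S) = ~: S.
      apply/setP => t; rewrite in_setU !in_setD in_setC -andb_orr; case: (t \in S) => //=.
      rewrite !inE; apply/negPn/negP; rewrite negb_or => /andP[nut nwt].
      have /setP/(_ w) : nb u = nb w by rewrite (nonadj _ _ nut) (nonadj _ _ nwt).
      by rewrite !inE uw edgexx.
    by rewrite cardsCs setCK cS pqd; move: cardG; clear; lia.
have /card_gt1P[y [y' [xy xy' yy']]] : 1 < #|nb x|.
  by rewrite -/(degree x) degx; move: p0 q0 pqd; clear; lia.
rewrite inE in xy; rewrite inE in xy'.
have nyy' : ~~ edge y y' by apply/negP => yy''; apply: (triangle x y y').
have [_ degy] := mG _ _ yy' nyy'.
rewrite -(cardsC (nb x)) -/(degree x) degx; suff -> : ~: nb x = nb y by rewrite -/(degree y) degy.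
apply/setP => w; rewrite !inE; apply/idP/idP => [nxw|yw].
  by have /setP/(_ y) := nonadj _ _ nxw; rewrite !inE xy edgeC.
by apply/negP => xw; apply: (triangle x y w).
Qed.

(** A vertex adjacent to all others could serve as [v_4], so [G] is [d]-regular. Its parts then all
    have size [#|G| - d], which divides [#|G|] and therefore [d]. *)
Lemma no_broom_divisor : p = 1 -> exists a, [/\ 2 < a, a %| d & #|G| = d + a].
Proof.
move=> p1; have mG := no_broom_multipartite; have [x [x1 [xx1 nxx1]]] := no_broom_nonadj.
have nonadj := multipartite_nonadj mG; have [/esym N1 degx] := mG _ _ xx1 nxx1.
have reg (u : G) : degree u = d.
  have [w /= /andP[uw nuw]|univ] := pickP [pred w | (u != w) && ~~ edge u w].
    by case: (mG _ _ uw nuw).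
  have adj w : u != w -> edge u w.
    by move=> uw; apply/negPn/negP => nuw; have := univ w; rewrite /= uw nuw.
  exfalso; have ux : u != x.
    by apply: contraNneq nxx1 => E; rewrite -E; apply: adj; rewrite E.
  have [y xy yu] : exists2 y, edge x y & y != u.
    have : 1 < #|nb x| by rewrite -/(degree x) degx; move: p1 q0 pqd; clear; lia.
    case/card_gt1P => y [y' [xy xy' yy']]; rewrite !inE in xy xy'.
    by case: (eqVneq y u) => E; [exists y'|exists y]; rewrite // -E eq_sym.
  have xu : edge x u by rewrite edgeC; apply: adj.
  have x1y : edge x1 y by have /setP/(_ y) := N1; rewrite !inE xy.
  have x1u : edge x1 u by have /setP/(_ u) := N1; rewrite !inE xu.
  have yx : edge y x by rewrite edgeC.
  pose S := [set y; x; u]; have cS : #|S| = 3 by apply: card_triple.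
  have uS : u \in S by rewrite !inE eqxx orbT.
  have hallu : d <= #|nb u :\: S|.
    have : #|G| <= #|u |: nb u|.
      apply/subset_leq_card/subsetP => w _; rewrite !inE eq_sym.
      by case: (eqVneq u w) => //=; apply: adj.
    have := card_nbD uS; rewrite cS cardsU1 inE edgexx -/(degree u).
    by move: cardG; clear; lia.
  apply: noT; apply: (T_graph_hall yx xu yu); rewrite -/S.
  - rewrite p1; apply/card_gt0P; exists x1; rewrite !inE (edgeC y) x1y andbT !negb_or.
    by rewrite (edge_neq x1y) eq_sym xx1 (edge_neq x1u).
  - by apply: leq_trans hallu; rewrite -pqd leq_addl.
  - by rewrite pqd; apply: leq_trans hallu _; apply/subset_leq_card/subsetUr.
have cG : d + (#|G| - d) = #|G| by move: cardG; clear; lia.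
exists (#|G| - d); split=> //; first by move: cardG; clear; lia.
(* The class of [u] under equality of neighbourhoods is the complement of [nb u]. *)
have block : {in preim_partition (@nb G) setT, forall A : {set G}, #|A| = #|G| - d}.
  move=> A /imsetP[u _ ->]; rewrite -(cardsC (nb u)) -/(degree u) reg addKn.
  apply: eq_card => w; rewrite !inE; apply/eqP/idP => [/setP/(_ w)|/nonadj//].
  by rewrite !inE edgexx => ->.
have := card_uniform_partition block (preim_partitionP _ _); rewrite cardsT => cP.
have : (#|G| - d) %| #|G| by rewrite {2}cP dvdn_mull.
by rewrite -{2}cG dvdn_addl.
Qed.

End NoDoubleBroom.

(** * From graphs to Ramsey numbers *)

Section LinearCombination.
Variable ps : seq nat.

Lemma linear_combination0 : linear_combination ps 0.
Proof. by exists (fun=> 0); rewrite big1. Qed.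

Lemma linear_combinationD x y : linear_combination ps x -> linear_combination ps y ->
  linear_combination ps (x + y).
Proof.
move=> [k ->] [l ->]; exists (fun i => k i + l i); rewrite -big_split /=.
by apply: eq_bigr => i _; rewrite mulnDl.
Qed.

Lemma linear_combination_mem x : x \in ps -> linear_combination ps x.
Proof.
move=> xps; have xi : index x ps < size ps by rewrite index_mem.
exists (fun i => i == Ordinal xi : nat); rewrite (bigD1 (Ordinal xi)) //= eqxx mul1n nth_index //.
by rewrite big1 ?addn0 // => i /negPf->.
Qed.

Lemma linear_combination_ind (P : nat -> Prop) N : P 0 ->
  (forall x y, P x -> P y -> P (x + y)) -> (forall x, x \in ps -> P x) ->
  linear_combination ps N -> P N.
Proof.
move=> P0 PD Pps [k ->]; elim/big_ind: _ => // i _.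
elim: (k i) => [|j IHj]; first by rewrite mul0n.
by rewrite mulSn; apply: PD => //; apply: Pps; apply: mem_nth.
Qed.

End LinearCombination.

(** * Induced subgraphs and components *)

Section Induced.
Variables (G : sgraph) (K : {set G}).

Definition induced_edge : rel {x | x \in K} := fun u v => edge (val u) (val v).

Lemma induced_edge_sym : symmetric induced_edge.
Proof. by move=> u v; rewrite /induced_edge edgeC. Qed.

Lemma induced_edge_irr : irreflexive induced_edge.
Proof. by move=> u; rewrite /induced_edge edgexx. Qed.

Definition induced : sgraph := SGraph induced_edge_sym induced_edge_irr.

Lemma induced_copy (T : sgraph) : contains_copy induced T -> contains_copy G T.
Proof.
case=> f fi fe; exists (val \o f); first exact: inj_comp val_inj fi.
by move=> x y /fe.
Qed.

Lemma card_induced : #|induced| = #|K|.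
Proof. by rewrite card_sig; apply: eq_card. Qed.

Lemma degree_induced (u : induced) :
  (forall y, edge (val u) y -> y \in K) -> degree u = degree (val u).
Proof.
move=> closed; rewrite /degree -(card_imset _ (@val_inj _ _ {x | x \in K})).
apply: eq_card => y; rewrite [RHS]inE; apply/imsetP/idP => [[v]|uy].
  by rewrite inE => uv ->.
by exists (Sub y (closed y uy) : {x | x \in K}); rewrite ?inE.
Qed.

End Induced.

(** Components keep all degrees and contain no copy of [T], and their sizes add up to [#|G|]. *)
Lemma components_linear_combination (G T : sgraph) d ps :
  (forall x : G, d <= degree x) -> ~ contains_copy G T ->
  (forall H : sgraph, connected H -> (forall x : H, d <= degree x) ->
     ~ contains_copy H T -> linear_combination ps #|H|) ->
  linear_combination ps #|G|.
Proof.
move=> degG noT comp; have symG : connect_sym (@edge G) by apply/sym_connect_sym/edge_sym.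
rewrite -cardsT (card_partition (preim_partitionP (root edge) [set: G])).
apply: big_ind => [||K /imsetP[r _ KE]].
- exact: linear_combination0.
- exact: linear_combinationD.
have inK v : (v \in K) = connect edge r v by rewrite KE !inE root_connect.
rewrite -card_induced; apply: comp => [|u|/induced_copy//].
  split; first by rewrite card_induced; apply/card_gt0P; exists r; rewrite inK.
  (* A path starting at [r] never leaves [K], so induction along it lifts it to the induced
     graph. *)
  have conK (v : induced K) : connect edge (Sub r (etrans (inK r) (connect0 _ r)) : induced K) v.
    case: v => v vK; have := vK; rewrite inK => /connectP[p pp E].
    elim/last_ind: p v vK pp E => [|p w IHp] v vK.
      by move=> _ /= E; rewrite (_ : Sub _ _ = exist _ v vK) //; apply: val_inj.
    rewrite rcons_path last_rcons => /andP[pp pw] E.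
    have lK : last r p \in K by rewrite inK; apply/connectP; exists p.
    apply: connect_trans (IHp _ lK pp erefl) (connect1 _).
    by rewrite /edge /= /induced_edge /= E.
  move=> u v; apply: connect_trans (conK v).
  by rewrite (sym_connect_sym (@edge_sym (induced K))).
rewrite degree_induced // => y uy; rewrite inK.
by apply: connect_trans (connect1 uy); rewrite -inK; apply: valP.
Qed.

(** * Stars, colourings and degrees *)

Lemma star_contained (H : sgraph) m (x : H) : m <= degree x -> contains_copy H (star m).
Proof.
move=> mx; pose f (i : 'I_m.+1) : H :=
  if unlift ord0 i is Some j then enum_val (A := mem (nb x)) (widen_ord mx j) else x.
have fx j : edge x (f (lift ord0 j)).
  by rewrite /f liftK; have := enum_valP (A := mem (nb x)) (widen_ord mx j); rewrite inE.
have f0 : f ord0 = x by rewrite /f unlift_none.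
exists f => [i j|i j].
  case: (unliftP ord0 i) => [i' ->|->]; case: (unliftP ord0 j) => [j' ->|->] //.
  - by rewrite /f !liftK => /enum_val_inj/(congr1 val) /= E; congr lift; apply: val_inj.
  - by rewrite f0 => E; have := fx i'; rewrite E edgexx.
  - by rewrite f0 => E; have := fx j'; rewrite -E edgexx.
rewrite -[edge i j]/(star_edge i j) /star_edge.
case: (unliftP ord0 i) => [i' ->|->]; case: (unliftP ord0 j) => [j' ->|->] //; rewrite f0 => _.
  by rewrite edgeC.
exact: fx.
Qed.

Lemma star_degree (H : sgraph) m : contains_copy H (star m) -> exists x : H, m <= degree x.
Proof.
case=> f fi fe; exists (f ord0).
have mE : #|[set f (lift ord0 j) | j : 'I_m]| = m.
  by rewrite card_imset ?card_ord // => i j /fi/lift_inj.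
rewrite -[X in X <= _]mE.
by apply/subset_leq_card/subsetP => y /imsetP[j _ ->]; rewrite inE; apply: fe.
Qed.

Lemma colour_degrees N (c : {set 'I_N} -> bool) (x : 'I_N) :
  degree (x : colour_class c true) + degree (x : colour_class c false) + 1 = N.
Proof.
pose A := nb (x : colour_class c true); pose B := nb (x : colour_class c false).
have AB : A :|: B = [set~ x].
  apply/setP => y; rewrite !inE /edge /= /colour_edge eq_sym.
  by case: (_ == _) => //=; case: (c _).
have AB0 : A :&: B = set0.
  apply/setP => y; rewrite !inE /edge /= /colour_edge.
  by case: (_ == _) => //=; case: (c _).
have := cardsC1 x; rewrite card_ord -AB cardsU AB0 cards0 subn0 /degree -/A -/B => ->.
by have := ltn_ord x; clear; lia.
Qed.

(** Without a blue star all blue degrees are below [m], so red degrees are at least [N - m]; the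
    bound is stated additively to avoid truncated subtraction. *)
Lemma ramsey_upper (T : sgraph) m N :
  (forall G : sgraph, #|G| = N -> (forall x : G, N <= degree x + m) -> contains_copy G T) ->
  ramsey_property T (star m) N.
Proof.
move=> H c; case: (pickP [pred x : colour_class c false | m <= degree x]) => [x mx|small].
  by right; apply: star_contained mx.
left; apply: H => [|x]; first exact: card_ord.
have := small x; rewrite /= leqNgt => /negbFE.
by have := colour_degrees c x; clear; lia.
Qed.

(** The edges of [G] are coloured red and all other pairs blue; blue degrees are then below [m]. *)
Lemma ramsey_lower (G T : sgraph) m : (forall x : G, #|G| <= degree x + m) ->
  ~ contains_copy G T -> ~ ramsey_property T (star m) #|G|.
Proof.
move=> degG noT R.
pose c (E : {set 'I_#|G|}) := [exists x in E, exists y in E, edge (enum_val x : G) (enum_val y)].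
have cE (x y : 'I_#|G|) : c [set x; y] = edge (enum_val x : G) (enum_val y).
  apply/existsP/idP => [[u /andP[uxy /existsP[v /andP[vxy]]]]|xy].
    move: uxy vxy; rewrite !inE => /orP[] /eqP-> /orP[] /eqP-> //; rewrite ?edgexx //.
    by rewrite edgeC.
  by exists x; rewrite !inE eqxx; apply/existsP; exists y; rewrite !inE eqxx orbT.
case: (R c) => [[f fi fe]|/star_degree[x]].
  apply: noT; exists (fun t => enum_val (f t) : G) => [s t /enum_val_inj/fi//|s t /fe].
  by rewrite /edge /= /colour_edge cE => /andP[_ /eqP].
have dx : degree (x : colour_class c true) = degree (enum_val x : G).
  rewrite /degree -(card_imset _ (@enum_val_inj _ (mem G))); apply: eq_card => y.
  rewrite [RHS]inE; apply/imsetP/idP => [[z]|xy].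
    by rewrite inE /edge /= /colour_edge cE => /andP[_ /eqP xz ->].
  exists (enum_rank y); last by rewrite enum_rankK.
  rewrite inE /edge /= /colour_edge cE enum_rankK xy eqxx andbT.
  by apply: contraTneq xy => ->; rewrite enum_rankK edgexx.
have := colour_degrees c x; rewrite dx; have := degG (enum_val x); clear; lia.
Qed.

Lemma ramsey_mono (T H : sgraph) M N : M <= N -> ramsey_property T H M ->
  ramsey_property T H N.
Proof.
move=> MN R c; pose w := widen_ord MN; pose c' (E : {set 'I_M}) := c (w @: E).
have wi : injective w by move=> i j /(congr1 val) /= E; apply: val_inj.
have lift b (S : sgraph) : contains_copy (colour_class c' b) S -> contains_copy (colour_class c b) S.
  case=> f fi fe; exists (w \o f); first exact: inj_comp wi fi.
  move=> x y /fe; rewrite /edge /= /colour_edge /c' imsetU !imset_set1.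
  by rewrite (inj_eq wi).
by case: (R c') => /lift; [left|right].
Qed.

Lemma is_ramsey_number_intro (T : sgraph) m N :
  (forall G : sgraph, #|G| = N -> (forall x : G, N <= degree x + m) -> contains_copy G T) ->
  (exists G : sgraph, [/\ #|G|.+1 = N, forall x : G, #|G| <= degree x + m & ~ contains_copy G T]) ->
  is_ramsey_number T (star m) N.
Proof.
move=> up [G [GN degG noT]]; split; first exact: ramsey_upper.
move=> M RM; rewrite leqNgt; apply/negP => MN.
by apply: (ramsey_lower degG noT); apply: ramsey_mono RM; rewrite -ltnS GN.
Qed.

(** * Extremal graphs: disjoint unions and complete multipartite graphs *)

Section DisjointUnion.
Variables G H : sgraph.

Definition union_edge : rel (G + H)%type := fun u v =>
  match u, v with
  | inl x, inl y => edge x y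
  | inr x, inr y => edge x y
  | _, _ => false
  end.

Lemma union_edge_sym : symmetric union_edge.
Proof. by move=> [x|x] [y|y] //=; rewrite edgeC. Qed.

Lemma union_edge_irr : irreflexive union_edge.
Proof. by move=> [x|x] /=; rewrite edgexx. Qed.

Definition disjoint_union : sgraph := SGraph union_edge_sym union_edge_irr.

Lemma degree_inl (x : G) : degree (inl x : disjoint_union) = degree x.
Proof.
rewrite /degree -(card_imset _ (@inl_inj G H)); apply: eq_card => -[y|y]; rewrite inE.
  by rewrite mem_imset ?inE //; apply: inl_inj.
by symmetry; apply/negP => /imsetP[].
Qed.

Lemma degree_inr (x : H) : degree (inr x : disjoint_union) = degree x.
Proof.
rewrite /degree -(card_imset _ (@inr_inj G H)); apply: eq_card => -[y|y]; rewrite inE.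
  by symmetry; apply/negP => /imsetP[].
by rewrite mem_imset ?inE //; apply: inr_inj.
Qed.

Lemma union_copy (T : sgraph) : connected T -> contains_copy disjoint_union T ->
  contains_copy G T \/ contains_copy H T.
Proof.
move=> [/card_gt0P[t0 _] coT] [f fi fe].
case E0: (f t0) => [x|x]; [left|right].
  have side t : exists y, f t = inl y.
    apply: (@closed_stays _ (fun t => exists y, f t = inl y) t0 t _ _ (coT t0 t)).
      by move=> u v [y Eu] /fe; rewrite Eu; case: (f v) => // z _; exists z.
    by exists x.
  pose g t := if f t is inl y then y else x.
  have fg t : f t = inl (g t) by rewrite /g; have [y ->] := side t.
  exists g => [s t E|s t /fe]; first by apply: fi; rewrite !fg E.
  by rewrite !fg.
have side t : exists y, f t = inr y.
  apply: (@closed_stays _ (fun t => exists y, f t = inr y) t0 t _ _ (coT t0 t)).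
    by move=> u v [y Eu] /fe; rewrite Eu; case: (f v) => // z _; exists z.
  by exists x.
pose g t := if f t is inr y then y else x.
have fg t : f t = inr (g t) by rewrite /g; have [y ->] := side t.
exists g => [s t E|s t /fe]; first by apply: fi; rewrite !fg E.
by rewrite !fg.
Qed.

End DisjointUnion.

Section Multipart.
Variables a j : nat.

(** The second coordinate names the part. [multipart 1 s] is a complete graph, [multipart d 2] is
    [K_{d,d}], and [multipart 0 0] has no vertices. *)
Definition multipart_edge : rel ('I_a * 'I_j)%type := fun u v => u.2 != v.2.

Lemma multipart_edge_sym : symmetric multipart_edge.
Proof. by move=> u v; rewrite /multipart_edge eq_sym. Qed.

Lemma multipart_edge_irr : irreflexive multipart_edge.
Proof. by move=> u; rewrite /multipart_edge eqxx. Qed.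

Definition multipart : sgraph := SGraph multipart_edge_sym multipart_edge_irr.

Lemma card_multipart : #|multipart| = a * j.
Proof. by rewrite card_prod !card_ord. Qed.

Lemma degree_multipart (u : multipart) : degree u = a * j.-1.
Proof.
have -> : degree u = #|setX [set: 'I_a] [set~ u.2]|.
  by apply: eq_card => v; rewrite !inE eq_sym.
by rewrite cardsX cardsT card_ord cardsC1 card_ord.
Qed.

End Multipart.

(** * The Ramsey numbers *)

Lemma contains_copy_card (G T : sgraph) : contains_copy G T -> #|T| <= #|G|.
Proof. by case=> f fi _; rewrite -(card_codom fi) max_card. Qed.

Lemma degree_lt_card (G : sgraph) (x : G) : degree x < #|G|.
Proof.
have := subset_leq_card (subsetT (x |: nb x)).
by rewrite cardsT cardsU1 inE edgexx.
Qed.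

Lemma T_graph_connected p q : connected (T_graph p q).
Proof.
pose v3 : T_graph p q := inl (inord 1).
have c0 : connect edge v3 (inl ord0) by apply: connect1; rewrite /edge /= /T_edge /= inordK.
have c2 : connect edge v3 (inl (inord 2)).
  by apply: connect1; rewrite /edge /= /T_edge /= !inordK.
have cv v : connect edge v3 v.
  case: v => [i|[i|i]].
  - case: i => -[|[|[|i]]] hi //.
    + by rewrite (_ : Ordinal hi = ord0) //; apply: val_inj.
    + by rewrite (_ : Ordinal hi = inord 1) ?connect0 //; apply: val_inj; rewrite /= inordK.
    + by rewrite (_ : Ordinal hi = inord 2) //; apply: val_inj; rewrite /= inordK.
  - exact: connect_trans c0 (connect1 _).
  - by apply: connect_trans c2 (connect1 _); rewrite /edge /= /T_edge /= inordK.
split; first by apply/card_gt0P; exists v3.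
move=> u v; apply: connect_trans (cv v).
by rewrite (sym_connect_sym (@T_edge_sym p q)).
Qed.

Lemma card_T_graph p q : #|T_graph p q| = p + q + 3.
Proof. by rewrite card_sum card_ord card_sum !card_ord addnC. Qed.

(** [v_3] and all the leaves fall into one part: [p + q + 1] vertices in a part of size [p + q]. *)
Lemma T_graph_not_in_bipartite p q :
  ~ contains_copy (multipart (p + q) 2) (T_graph p q).
Proof.
case=> f fi fe.
have side (u v : T_graph p q) : edge u v -> (f u).2 = rev_ord (f v).2.
  move=> /fe; rewrite /edge /= /multipart_edge.
  by case: (f u).2 (f v).2 => -[|[|i]] hi // [[|[|j]] hj] // _; apply: val_inj.
pose v3 : T_graph p q := inl (inord 1).
pose v2 : T_graph p q := inl ord0.
pose v4 : T_graph p q := inl (inord 2).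
have e23 : edge v2 v3 by rewrite /edge /= /T_edge /= inordK.
have e43 : edge v4 v3 by rewrite /edge /= /T_edge /= !inordK.
pose far : pred (T_graph p q) := fun u => if u is inl i then i == 1 :> nat else true.
have farS u : far u -> (f u).2 = (f v3).2.
  case: u => [i /eqP i1|[i|i] _].
  - by rewrite (_ : inl i = v3) // /v3; congr inl; apply: val_inj; rewrite /= inordK.
  - by rewrite (side _ v2) // (side _ _ e23) rev_ordK.
  - rewrite (side _ v4) ?(side _ _ e43) ?rev_ordK //.
    by rewrite /edge /= /T_edge /= inordK.
pose g (u : option ('I_p + 'I_q)) : T_graph p q := if u is Some w then inr w else v3.
have gi : injective g by move=> [u|] [v|] //= [->].
have fg u : far (g u) by case: u => //=; rewrite /far /= inordK.
have hi : injective (fun u => (f (g u)).1).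
  move=> u v E; apply: gi; apply: fi; apply: injective_projections => //.
  by rewrite !(farS (g _)).
have := leq_card _ hi; rewrite card_option card_sum !card_ord; clear; lia.
Qed.

(** The [q + 1] neighbours of [v_4] use up the whole neighbourhood of its image, so [v_2] and its
    leaf both land in the part of [v_4], although they are adjacent. *)
Lemma T_graph1_not_in_multipart a j q : q + 1 = a * j.-1 ->
  ~ contains_copy (multipart a j) (T_graph 1 q).
Proof.
move=> qE [f fi fe].
pose v1 : T_graph 1 q := inr (inl ord0).
pose v2 : T_graph 1 q := inl ord0.
pose v3 : T_graph 1 q := inl (inord 1).
pose v4 : T_graph 1 q := inl (inord 2).
pose g (u : option 'I_q) : T_graph 1 q := if u is Some w then inr (inr w) else v3.
have gi : injective g by move=> [u|] [v|] //= [->].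
have g4 u : edge v4 (g u).
  by case: u => [u|]; rewrite /edge /= /T_edge /= !inordK.
have nb4 : nb (f v4) = (f \o g) @: setT.
  apply/eqP; rewrite eq_sym eqEcard card_imset; last exact: inj_comp fi gi.
  rewrite cardsT card_option card_ord -/(degree (f v4)) degree_multipart -qE addn1 leqnn andbT.
  by apply/subsetP => _ /imsetP[u _ ->]; rewrite inE; apply: fe.
have same v : (forall u, v != g u) -> (f v).2 = (f v4).2.
  move=> vg; apply/eqP/negPn/negP => nv.
  have : f v \in nb (f v4) by rewrite inE /edge /= /multipart_edge eq_sym.
  by rewrite nb4 => /imsetP[u _ /fi] E; have := vg u; rewrite E eqxx.
have : edge (f v2) (f v1) by apply: fe.
rewrite /edge /= /multipart_edge !same ?eqxx //.
- by case.
- case=> [//|]; apply/eqP => /(congr1 (fun u : T_vertex 1 q => if u is inl i then val i else 0)).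
  by rewrite /= inordK.
Qed.

(** Disjoint unions add sizes and create no copy of a connected [T]; the empty graph realises 0. *)
Lemma linear_combination_graph (T : sgraph) d ps N : connected T ->
  (forall s, s \in ps -> exists G : sgraph,
     [/\ #|G| = s, forall x : G, d <= degree x & ~ contains_copy G T]) ->
  linear_combination ps N ->
  exists G : sgraph, [/\ #|G| = N, forall x : G, d <= degree x & ~ contains_copy G T].
Proof.
pose P s := exists G : sgraph,
  [/\ #|G| = s, forall x : G, d <= degree x & ~ contains_copy G T].
move=> coT good; apply: (@linear_combination_ind ps P) => //.
  have c0 : #|multipart 0 0| = 0 by rewrite card_multipart.
  exists (multipart 0 0); split=> // [x|/contains_copy_card].
    by have : 0 < #|multipart 0 0| by [apply/card_gt0P; exists x]; rewrite c0.
  by rewrite c0; case: coT; case: #|T|.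
move=> _ _ [G [<- dG nG]] [H [<- dH nH]]; exists (disjoint_union G H).
split=> [|[x|x]|/(union_copy coT)[]//]; first exact: card_sum.
  by rewrite degree_inl.
by rewrite degree_inr.
Qed.

Lemma clique_avoids (T : sgraph) d s : d < s -> s < #|T| -> exists G : sgraph,
  [/\ #|G| = s, forall x : G, d <= degree x & ~ contains_copy G T].
Proof.
move=> ds sT; exists (multipart 1 s); rewrite card_multipart mul1n; split=> // [x|].
  by rewrite degree_multipart; move: ds; clear; lia.
by move/contains_copy_card; rewrite card_multipart mul1n leqNgt sT.
Qed.

Section Bounds.
Variables (d k : nat).
Hypothesis hk : k + 2 <= d.
Let m := k * (d + 2) + 3.

(** For the lower bound, [k + 1] disjoint copies of the complete graph on [d + 2] vertices have
    [m + d - 1] vertices, all of degree [d + 1]. *)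
Lemma ramsey_number_low (T : sgraph) : connected T -> #|T| = d + 3 ->
  (forall G : sgraph, #|G| = m + d -> (forall x : G, d <= degree x) -> contains_copy G T) ->
  is_ramsey_number T (star m) (m + d).
Proof.
move=> coT cT up; apply: is_ramsey_number_intro => [G GN degG|].
  by apply: up => // x; move: (degG x); clear; lia.
have [||G [GN degG noT]] := @linear_combination_graph T (d + 1) [:: d + 2] (k.+1 * (d + 2)) coT.
- move=> s; rewrite inE => /eqP->; apply: clique_avoids; rewrite ?cT; clear; lia.
- by exists (fun=> k.+1); rewrite big_ord1.
exists G; split=> // [|x]; rewrite GN /m; first by clear; lia.
by move: (degG x); clear; lia.
Qed.

Lemma no_copy_linear_combination (T G : sgraph) ps : d + 2 \in ps -> d + 1 \in ps ->
  (forall H : sgraph, connected H -> (forall x : H, d <= degree x) -> d + 3 <= #|H| ->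
     ~ contains_copy H T -> linear_combination ps #|H|) ->
  (forall x : G, d <= degree x) -> ~ contains_copy G T -> linear_combination ps #|G|.
Proof.
move=> d2 d1 big degG noT; apply: components_linear_combination degG noT _ => H coH degH noT.
have [/card_gt0P[x _] _] := coH; have := leq_ltn_trans (degH x) (degree_lt_card x) => dH.
have [dH3|Hd] := leqP (d + 3) #|H|; first exact: big.
have [->|->] : #|H| = d + 2 \/ #|H| = d + 1 by move: dH Hd; clear; lia.
  exact: linear_combination_mem.
exact: linear_combination_mem.
Qed.

(** Here [m + d = (k+1)(d+2) + 1]. At least [k + 2] summands are needed; with [k + 2 + s] of them,
    the number [y] of summands [d + 1] satisfies [(s+1)(d+2) = 1 + y], so [(s+1)(d+1) <= k + 2],
    contrary to [k + 2 <= d]. *)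
Lemma not_linear_combination : ~ linear_combination [:: d + 2; d + 1] (m + d).
Proof.
case=> l; rewrite big_ord_recl big_ord1 /= => E.
set x := l ord0 in E; set y := l _ in E.
have {}E : (x + y) * (d + 2) = k.+1 * (d + 2) + 1 + y by move: E; rewrite /m; clear; nia.
have kt : k.+1 < x + y.
  by rewrite ltnNge; apply/negP => H; move: (leq_mul2r (d + 2) (x + y) k.+1) E; rewrite H orbT; clear; lia.
have [s st] : exists s, x + y = k.+2 + s by exists (x + y - k.+2); move: kt; clear; lia.
have {}E : s.+1 * (d + 2) = 1 + y.
  by move: E; rewrite st; clear; nia.
have : s.+1 * (d + 1) <= k + 2 by move: E st; clear; nia.
by move: hk; clear; nia.
Qed.

Lemma ramsey_number_tree (T : sgraph) : is_tree T -> #|T| = d + 3 -> max_degree T <= d ->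
  (forall p, 1 <= p -> 1 <= d - p -> ~ isomorphic T (T_graph p (d - p))) ->
  is_ramsey_number T (star m) (m + d).
Proof.
move=> tT cT maxT notTpq; apply: ramsey_number_low => //; first by case: tT.
move=> G GN degG; have [//|noT] := contains_copy_dec G T.
case: not_linear_combination; rewrite -GN.
apply: no_copy_linear_combination degG noT; rewrite ?inE ?eqxx ?orbT // => H coH degH cH [].
exact: tree_contained degH cH.
Qed.

Section DoubleBroom.
Variables (p q : nat) (ps : seq nat).
Hypotheses (pqd : p + q = d) (p0 : 0 < p) (q0 : 0 < q).
Hypotheses (d2 : d + 2 \in ps) (d1 : d + 1 \in ps).

Lemma ramsey_number_double_broom_low :
  (forall H : sgraph, connected H -> (forall x : H, d <= degree x) -> d + 3 <= #|H| ->
     ~ contains_copy H (T_graph p q) -> linear_combination ps #|H|) ->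
  ~ linear_combination ps (m + d) ->
  is_ramsey_number (T_graph p q) (star m) (m + d).
Proof.
move=> big nlc; apply: ramsey_number_low.
- exact: T_graph_connected.
- by rewrite card_T_graph pqd.
move=> G GN degG; have [//|noT] := contains_copy_dec G (T_graph p q).
by case: nlc; rewrite -GN; apply: no_copy_linear_combination degG noT.
Qed.

(** On [m + d + 1] vertices degrees are at least [d + 1], and [no_broom_degree] excludes components
    larger than [d + 2]. All components have [d + 2] vertices, but [d + 2] does not divide
    [(k+1)(d+2) + 2]. *)
Lemma ramsey_number_double_broom_high :
  (forall s, s \in ps -> exists G : sgraph,
     [/\ #|G| = s, forall x : G, d <= degree x & ~ contains_copy G (T_graph p q)]) ->
  linear_combination ps (m + d) ->
  is_ramsey_number (T_graph p q) (star m) (m + d + 1).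
Proof.
move=> good lc; apply: is_ramsey_number_intro => [G GN degG|]; last first.
  have [G [GN degG noT]] := linear_combination_graph (T_graph_connected p q) good lc.
  by exists G; split=> // [|x]; rewrite GN ?addn1 // addnC leq_add2r.
have [//|noT] := contains_copy_dec G (T_graph p q).
have degG' (x : G) : d + 1 <= degree x by move: (degG x); clear; lia.
have : linear_combination [:: d + 2] #|G|.
  apply: components_linear_combination degG' noT _ => H coH degH noT.
  have [/card_gt0P[x _] _] := coH; have dH := leq_ltn_trans (degH x) (degree_lt_card x).
  have degH' (y : H) : d <= degree y by move: (degH y); clear; lia.
  have [dH3|Hd] := leqP (d + 3) #|H|.
    have [y dy] := no_broom_degree pqd p0 q0 coH degH' dH3 noT.
    by move: (degH y); rewrite dy; clear; lia.
  have -> : #|H| = d + 2 by move: dH Hd; clear; lia.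
  by apply: linear_combination_mem; rewrite inE.
case=> l; rewrite big_ord1 GN /= => E.
have : d + 2 %| k.+1 * (d + 2) + 2.
  have -> : k.+1 * (d + 2) + 2 = l ord0 * (d + 2) by rewrite -E /m; clear; lia.
  exact: dvdn_mull.
rewrite dvdn_addr ?dvdn_mull // => /dvdn_leq; move: hk; clear; lia.
Qed.

End DoubleBroom.

End Bounds.

Theorem theorem1p5 (n k m : nat) (hn : 0 < n) (hk : k + 5 <= n)
    (hm : m = k * (n - 1) + 3) :
  (forall Tn : sgraph,
      is_tree Tn -> #|Tn| = n -> max_degree Tn <= n - 3 ->
      (forall p : nat, 1 <= p -> 1 <= n - 3 - p ->
         ~ isomorphic Tn (T_graph p (n - 3 - p))) ->
      is_ramsey_number Tn (star m) (m + n - 3))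
  /\
  (let ps := [:: n - 1, n - 2 & [seq n - 3 + a | a <- divisors (n - 3) & 3 <= a]] in
   (~ linear_combination ps (m + n - 3) ->
      is_ramsey_number (T_graph 1 (n - 4)) (star m) (m + n - 3)) /\
   (linear_combination ps (m + n - 3) ->
      is_ramsey_number (T_graph 1 (n - 4)) (star m) (m + n - 2)))
  /\
  (forall p : nat, 2 <= p -> 2 <= n - 3 - p ->
   let ps := [:: 2 * n - 6; n - 1; n - 2] in
   (~ linear_combination ps (m + n - 3) ->
      is_ramsey_number (T_graph p (n - 3 - p)) (star m) (m + n - 3)) /\
   (linear_combination ps (m + n - 3) ->
      is_ramsey_number (T_graph p (n - 3 - p)) (star m) (m + n - 2))).
Proof.
(* The statement is rewritten in terms of [d = n - 3], which removes most truncated subtractions. *)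
have [d nd] : exists d, n = d + 3 by exists (n - 3); move: hk; clear; lia.
have {}hk : k + 2 <= d by move: hk; rewrite nd; clear; lia.
have n1 : n - 1 = d + 2 by rewrite nd; clear; lia.
have n2 : n - 2 = d + 1 by rewrite nd; clear; lia.
have n3 : n - 3 = d by rewrite nd; clear; lia.
have n4 : n - 4 = d - 1 by rewrite nd; clear; lia.
have n6 : 2 * n - 6 = d * 2 by rewrite nd; clear; lia.
have mn3 : m + n - 3 = m + d by rewrite nd; clear; lia.
have mn2 : m + n - 2 = m + d + 1 by rewrite nd; clear; lia.
rewrite mn3 mn2 n1 n2 n3 n4 n6 hm n1 {mn3 mn2 n1 n2 n3 n4 n6 hm hn m}.
have small s (T : sgraph) : #|T| = d + 3 -> s = d + 2 \/ s = d + 1 -> exists G : sgraph,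
    [/\ #|G| = s, forall x : G, d <= degree x & ~ contains_copy G T].
  by move=> cT sd; apply: clique_avoids; rewrite ?cT; move: sd; clear; lia.
split=> [T tT cT maxT notTpq|]; first by apply: ramsey_number_tree; rewrite ?cT.
split=> [ps|p p2 q2 ps].
  have pqd : 1 + (d - 1) = d by move: hk; clear; lia.
  have q0 : 0 < d - 1 by move: hk; clear; lia.
  have d2 : d + 2 \in ps by rewrite inE eqxx.
  have d1 : d + 1 \in ps by rewrite !inE eqxx orbT.
  split; first (apply: (ramsey_number_double_broom_low pqd d2 d1) => // H coH degH cH noT).
    have [a [a3 ad ->]] := no_broom_divisor pqd isT q0 coH degH cH noT erefl.
    apply: linear_combination_mem; rewrite !inE; apply/orP; right; apply/orP; right.
    apply: map_f; rewrite mem_filter a3 -dvdn_divisors //; move: hk; clear; lia.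
  apply: (ramsey_number_double_broom_high hk pqd) => // s; rewrite !inE.
  case/or3P => [/eqP->|/eqP->|/mapP[a]].
  - by apply: small; [rewrite card_T_graph pqd|left].
  - by apply: small; [rewrite card_T_graph pqd|right].
  rewrite mem_filter -dvdn_divisors; last by move: hk; clear; lia.
  (* With [d = j a], the graph with [j + 1] parts of size [a] has [d + a] vertices and is
     [d]-regular. *)
  case/andP=> a3 /dvdnP[j jd] ->; exists (multipart a j.+1).
  rewrite card_multipart mulnS mulnC -jd addnC; split=> // [x|].
    by rewrite degree_multipart mulnC -jd.
  by apply: T_graph1_not_in_multipart; rewrite /= mulnC -jd addnC.
have pqd : p + (d - p) = d by move: q2; clear; lia.
have p0 : 0 < p by apply: ltnW.
have q0 : 0 < d - p by apply: ltnW.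
have d2 : d + 2 \in ps by rewrite !inE eqxx orbT.
have d1 : d + 1 \in ps by rewrite !inE eqxx !orbT.
split; first (apply: (ramsey_number_double_broom_low pqd d2 d1) => // H coH degH cH noT).
  apply: linear_combination_mem.
  by rewrite (no_broom_bipartite pqd p0 q0 coH degH cH noT p2 q2) !inE muln2 addnn eqxx.
apply: (ramsey_number_double_broom_high hk pqd) => // s; rewrite !inE.
case/or3P => /eqP->.
(* The summand [2n - 6 = 2d] is realised by [K_{d,d}]. *)
- exists (multipart d 2); rewrite card_multipart; split=> // [x|].
    by rewrite degree_multipart muln1.
  by rewrite -{1}pqd; apply: T_graph_not_in_bipartite.
- by apply: small; [rewrite card_T_graph pqd|left].
- by apply: small; [rewrite card_T_graph pqd|right].
Qed.
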